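(* Suppose that Assumptions A, B, C-3 and C-4 (stated in the context) hold. Let $\{(x^r,y^r)\}$ be a sequence generated by the HiBSA algorithm with $U_y(u;x,y)=f(x,u)-\frac{1}{2\rho}\|u-y\|^2$, where $f(x,y)=y^TF(x)$, and with parameter sequences $\{\gamma^r\},\{\beta^r\}$ as in Assumption C-3. For a given $\epsilon>0$ let $$T(\epsilon):=\min\{r \mid \|\nabla\mathcal{G}^{\beta^{r+1}}_{\rho}(x^{r+1},y^{r+1})\|\le\epsilon,\ r\ge 1\}.$$ Then $T(\epsilon)=\widetilde{\mathcal{O}}\left(\frac{1}{\epsilon^4}\right)$, where $\widetilde{\mathcal{O}}$ denotes $\mathcal{O}$ up to logarithmic factors.
   Context: Problem. $\min_x\max_y \ell(x,y):=f(x_1,\dots,x_K,y)+\sum_{i=1}^K h_i(x_i)-g(y)$ subject to $x_i\in\mathcal{X}_i$ ($i=1,\dots,K$), $y\in\mathcal{Y}$, with $x=[x_1;\dots;x_K]\in\mathbb{R}^{NK}$, $x_i\in\mathbb{R}^N$, $y\in\mathbb{R}^M$, $\mathcal{X}=\mathcal{X}_1\times\dots\times\mathcal{X}_K$. $\|\cdot\|$ is the Euclidean norm; $x_{-i}$ denotes $x$ with block $i$ removed. Assumption A. (A.1) $f:\mathbb{R}^{KN+M}\to\mathbb{R}$ is continuously differentiable; $\mathcal{X}_i$ and $\mathcal{Y}$ are convex and compact; $\ell(x,y)\ge\underline{\ell}$ for all $x\in\mathcal{X},y\in\mathcal{Y}$. (A.2) $h_i:\mathbb{R}^N\to\mathbb{R}$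 and $g:\mathbb{R}^M\to\mathbb{R}$ are convex (possibly non-smooth). (A.3) For all $z,\bar z\in\mathcal{X}\times\mathcal{Y}$: $\|\nabla_{x_i}f(\bar z)-\nabla_{x_i}f(z)\|\le L_{x_i}\|\bar z-z\|$ for every $i$, and $\|\nabla_y f(\bar z)-\nabla_y f(z)\|\le L_y\|\bar z-z\|$. Assumption B (approximation functions $U_i(\cdot;w,y):\mathbb{R}^N\to\mathbb{R}$). (B.1) Each $U_i(\cdot;w,y)$ is strongly convex with modulus $\mu_i>0$: $U_i(x_i;w,y)-U_i(z_i;w,y)\ge\langle\nabla_{z_i}U_i(z_i;w,y),x_i-z_i\rangle+\frac{\mu_i}{2}\|x_i-z_i\|^2$ for all $w\in\mathcal{X},y\in\mathcal{Y},x_i,z_i\in\mathcal{X}_i$. (B.2) $\nabla_{z_i}U_i(z_i;x,y)|_{z_i=x_i}=\nabla_{x_i}f(x,y)$ for all $i$, $x\in\mathcal{X},y\in\mathcal{Y}$. (B.3) $U_i(z_i;x,y)\ge f(z_i,x_{-i},y)$ and $U_i(x_i;x,y)=f(x,y)$ for all $x\in\mathcal{X},y\in\mathcal{Y},z_i\in\mathcal{X}_i$. (B.4) $\|\nabla U_i(z_i;w,y)-\nabla U_i(v_i;w,y)\|\le L_{u_i}\|v_i-z_i\|$ (gradient in the first argument) for all $w\in\mathcal{X},y\in\mathcal{Y},v_i,z_i\in\mathcal{X}_i$. Put $\mu:=\min_i\mu_i$. Assumption C-3. (1) $\{\gamma^r\}$ is a positive sequence with $\gamma^r-\gamma^{r+1}\ge0$,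 $\gamma^r\to0$, $\sum_{r=1}^\infty(\gamma^r)^2=\infty$, and $\frac{1}{\gamma^{r+1}}-\frac{1}{\gamma^r}\le\frac{\rho}{5}$ for all $r$. (2) For all $r$: $\beta^r>\rho L_y^2+\frac{4L_y^2}{\rho(\gamma^r)^2}-2\mu$ and $\beta^r>L_{x_i}$ for all $i$. (For example, the condition on $\{\gamma^r\}$ is satisfied by $\gamma^r=\frac{1}{\rho r^{1/4}}$.) Assumption C-4. The coupling term is linear in $y$: $f(x,y)=y^TF(x_1,\dots,x_K)$ for a vector function $F:\mathbb{R}^{NK}\to\mathbb{R}^M$; and $U_y(u;x,y)=f(x,u)-\frac{1}{2\rho}\|u-y\|^2$ with a fixed $\rho>0$. HiBSA algorithm. From a starting point $(x^1,y^1)\in\mathcal{X}\times\mathcal{Y}$, at each iteration $r=1,2,\dots$: for $i=1,\dots,K$ in order, with $w_i^{r+1}:=[x_1^{r+1};\dots;x_{i-1}^{r+1};x_i^r;\dots;x_K^r]$, $$x_i^{r+1}=\arg\min_{x_i\in\mathcal{X}_i}U_i(x_i;w_i^{r+1},y^r)+h_i(x_i)+\frac{\beta^r}{2}\|x_i-x_i^r\|^2;$$ then $y^{r+1}=\arg\max_{y\in\mathcal{Y}}U_y(y;x^{r+1},y^r)-g(y)-\frac{\gamma^r}{2}\|y\|^2$. Stationarity gap. $\mathrm{Px}_i^{\beta}(v_i):=\arg\min_{x_i\in\mathcal{X}_i}h_i(x_i)+\frac{\beta}{2}\|x_i-v_i\|^2$, $\mathrm{Py}^{1/\rho}(w):=\arg\max_{y\in\mathcal{Y}}-g(y)-\frac{1}{2\rho}\|y-w\|^2$.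 $\nabla\mathcal{G}^{\beta}_{\rho}(x,y)$ (a symbol, not a gradient) is the stacked vector with blocks $\beta\big(x_i-\mathrm{Px}_i^{\beta}(x_i-\frac1\beta\nabla_{x_i}f(x,y))\big)$, $i=1,\dots,K$, and last block $\frac1\rho\big(y-\mathrm{Py}^{1/\rho}(y+\rho\nabla_y f(x,y))\big)$.
   Formalization: Added assumption: up to logarithmic factors, γ^r = O(r^{-1/4}) and β^r = O(r^{1/2}). Assumption C-3 alone bounds β^r only from below and lets γ^r vanish arbitrarily slowly; e.g. with β^r = 8·2^r the gap can stay equal to 1, so T(ε) need not exist. *)

(* Defs.v *)
From HB Require Import structures.
From mathcomp Require Import all_boot all_order all_algebra.
From mathcomp Require Import all_classical all_reals all_analysis.

Set Implicit Arguments.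
Unset Strict Implicit.
Unset Printing Implicit Defensive.

Import Order.TTheory GRing.Theory Num.Theory.
Import numFieldNormedType.Exports.

Local Open Scope classical_set_scope.
Local Open Scope ring_scope.

(* Conventions.  There are K.+1 (at least one) blocks, indexed by 'I_K.+1.    *)
(* A point x = [x_1; ...; x_{K+1}] is a matrix x : 'M_(K.+1, N) whose i-th    *)
(* row is the block x_i; y is a row vector; f takes the pair (x, y).          *)
(* The library's norm on matrices and pairs is the sup norm: it is used for   *)
(* the topology only (compactness, differentiability), all norms appearing in *)
(* formulas being Euclidean.                                                  *)

Section Euclidean.
Context {R : realType}.

Definition enorm m n (A : 'M[R]_(m, n)) : R :=
  Num.sqrt (\sum_i \sum_j A i j ^+ 2).

Definition enorm2 m n p q (z : 'M[R]_(m, n) * 'M[R]_(p, q)) : R :=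
  Num.sqrt (enorm z.1 ^+ 2 + enorm z.2 ^+ 2).

Definition dotp n (u v : 'rV[R]_n) : R := \sum_j u 0 j * v 0 j.

Definition grad n (phi : 'rV[R]_n -> R) (u : 'rV[R]_n) : 'rV[R]_n :=
  \row_j 'D_(delta_mx 0 j) (phi : 'rV[R]_n -> R^o) u.

Definition is_argmin (T : Type) (D : set T) (phi : T -> R) (u : T) : Prop :=
  D u /\ forall v, D v -> phi u <= phi v.

Definition is_argmax (T : Type) (D : set T) (phi : T -> R) (u : T) : Prop :=
  D u /\ forall v, D v -> phi v <= phi u.

(* u = O(v log^k v) along F, for some k *)
Definition softO (T : Type) (F : filter_on T) (u v : T -> R) : Prop :=
  exists k : nat,
    (u : T -> R^o) =O_F ((fun t => v t * `|ln (v t)| ^+ k) : T -> R^o).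

End Euclidean.

Definition is_least (P : nat -> Prop) (n : nat) : Prop :=
  P n /\ forall m, P m -> (n <= m)%N.

Section Problem.
Context {R : realType} {K N M : nat}.

Local Notation block := 'rV[R]_N.
Local Notation point := 'M[R]_(K.+1, N).
Local Notation dual := 'rV[R]_M.

Implicit Types (f : point * dual -> R) (h : 'I_K.+1 -> block -> R)
  (g : dual -> R) (X : 'I_K.+1 -> set block) (Y : set dual)
  (U : 'I_K.+1 -> block -> point -> dual -> R).

Definition prodX X : set point := [set x | forall i, X i (row i x)].

(* (v, x_{-i}) *)
Definition subst_block (x : point) (i : 'I_K.+1) (v : block) : point :=
  \matrix_(k, j) (if k == i then v 0 j else x k j).

Definition gradx f (i : 'I_K.+1) (z : point * dual) : block :=
  grad (fun v => f (subst_block z.1 i v, z.2)) (row i z.1).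

Definition grady f (z : point * dual) : dual :=
  grad (fun v => f (z.1, v)) z.2.

Definition objective f h g (x : point) (y : dual) : R :=
  f (x, y) + \sum_i h i (row i x) - g y.

Record assumptionA f h g X Y (Lx : 'I_K.+1 -> R) (Ly : R) : Prop := {
  A1_differentiable : forall z, differentiable (f : point * dual -> R^o) z;
  A1_gradx_continuous : forall i, continuous (gradx f i);
  A1_grady_continuous : continuous (grady f);
  A1_X_convex : forall i, convex_set (X i);
  A1_X_compact : forall i, compact (X i);
  A1_Y_convex : convex_set Y;
  A1_Y_compact : compact Y;
  A1_lower_bound : exists lb : R,
    forall x y, prodX X x -> Y y -> lb <= objective f h g x y;
  A2_h_convex : forall i, convex_function setT (h i);
  A2_g_convex : convex_function setT g;
  A3_gradx_lipschitz : forall i z z', (prodX X `*` Y) z -> (prodX X `*` Y) z' ->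
    enorm (gradx f i z' - gradx f i z) <= Lx i * enorm2 (z' - z);
  A3_grady_lipschitz : forall z z', (prodX X `*` Y) z -> (prodX X `*` Y) z' ->
    enorm (grady f z' - grady f z) <= Ly * enorm2 (z' - z)
}.

(* U i v w y is U_i(v; w, y).  Its differentiability in v, implicit in the    *)
(* use of its gradient, is required on X_i only.                              *)
Record assumptionB f X Y U (mu Lu : 'I_K.+1 -> R) : Prop := {
  B_differentiable : forall i w y v, prodX X w -> Y y -> X i v ->
    differentiable ((fun u => U i u w y) : block -> R^o) v;
  B1_modulus : forall i, 0 < mu i;
  B1_strongly_convex : forall i w y u v, prodX X w -> Y y -> X i u -> X i v ->
    dotp (grad (fun t => U i t w y) v) (u - v) + mu i / 2 * enorm (u - v) ^+ 2
      <= U i u w y - U i v w y;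
  B2_gradient : forall i x y, prodX X x -> Y y ->
    grad (fun t => U i t x y) (row i x) = gradx f i (x, y);
  B3_upper_bound : forall i x y v, prodX X x -> Y y -> X i v ->
    f (subst_block x i v, y) <= U i v x y;
  B3_tight : forall i x y, prodX X x -> Y y -> U i (row i x) x y = f (x, y);
  B4_lipschitz : forall i w y u v, prodX X w -> Y y -> X i u -> X i v ->
    enorm (grad (fun t => U i t w y) v - grad (fun t => U i t w y) u)
      <= Lu i * enorm (u - v)
}.

Definition min_modulus (mu : 'I_K.+1 -> R) : R :=
  \big[Num.min/mu ord0]_(i < K.+1) mu i.

(* Iterations are numbered from 1: the terms of index 0 of the sequences      *)
(* gamma, beta, xs and ys are never constrained nor used.                     *)
Record assumptionC3 (rho Ly : R) (Lx mu : 'I_K.+1 -> R) (gamma beta : nat -> R)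
    : Prop := {
  C3_positive : forall r, (1 <= r)%N -> 0 < gamma r;
  C3_decreasing : forall r, (1 <= r)%N -> 0 <= gamma r - gamma r.+1;
  C3_vanishing : gamma r @[r --> \oo] --> (0 : R);
  C3_square_sum : \sum_(1 <= r < n) gamma r ^+ 2 @[n --> \oo] --> +oo;
  C3_inverse : forall r, (1 <= r)%N -> (gamma r.+1)^-1 - (gamma r)^-1 <= rho / 5;
  C3_beta : forall r, (1 <= r)%N ->
    rho * Ly ^+ 2 + 4 * Ly ^+ 2 / (rho * gamma r ^+ 2) - 2 * min_modulus mu
      < beta r;
  C3_beta_Lx : forall r i, (1 <= r)%N -> Lx i < beta r
}.

(* The order of magnitude of the step parameters behind the eps^-4 rate,      *)
(* that of gamma r = 1 / (rho r^(1/4)) and of the resulting lower bound on    *)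
(* beta r.  The conditions of assumptionC3 do not imply it: they bound beta   *)
(* from below only, and allow gamma to vanish at other rates, such as         *)
(* r^(-1/2) or 1 / log r.                                                     *)
Definition rate_parameters (gamma beta : nat -> R) : Prop :=
  softO \oo gamma (fun r : nat => r%:R `^ (- 4^-1)) /\
  softO \oo beta (fun r : nat => Num.sqrt r%:R).

Definition assumptionC4 f (F : point -> dual) : Prop :=
  forall x y, f (x, y) = dotp y (F x).

Definition Uy f (rho : R) (u : dual) (x : point) (y : dual) : R :=
  f (x, u) - (2 * rho)^-1 * enorm (u - y) ^+ 2.

(* [x'_1; ...; x'_{i-1}; x_i; ...; x_{K+1}] *)
Definition splice (i : 'I_K.+1) (x' x : point) : point :=
  \matrix_(k, j) (if (k < i)%N then x' k j else x k j).

Record HiBSA f h g X Y U (rho : R) (gamma beta : nat -> R)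
    (xs : nat -> point) (ys : nat -> dual) : Prop := {
  HiBSA_x1 : prodX X (xs 1);
  HiBSA_y1 : Y (ys 1);
  HiBSA_x : forall r i, (1 <= r)%N ->
    is_argmin (X i)
      (fun v => U i v (splice i (xs r.+1) (xs r)) (ys r) + h i v
                + beta r / 2 * enorm (v - row i (xs r)) ^+ 2)
      (row i (xs r.+1));
  HiBSA_y : forall r, (1 <= r)%N ->
    is_argmax Y
      (fun u => Uy f rho u (xs r.+1) (ys r) - g u - gamma r / 2 * enorm u ^+ 2)
      (ys r.+1)
}.

Definition Px h X (b : R) (i : 'I_K.+1) (v : block) : block :=
  get (is_argmin (X i) (fun u => h i u + b / 2 * enorm (u - v) ^+ 2)).

Definition Py g Y (rho : R) (w : dual) : dual :=
  get (is_argmax Y (fun u => - g u - (2 * rho)^-1 * enorm (u - w) ^+ 2)).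

Definition gap f h g X Y (b rho : R) (x : point) (y : dual) : point * dual :=
  (\matrix_i (b *: (row i x
     - Px h X b i (row i x - b^-1 *: gradx f i (x, y)))),
   rho^-1 *: (y - Py g Y rho (y + rho *: grady f (x, y)))).

End Problem.

(* Main.v *)
Require Import Defs.
From mathcomp Require Import all_boot all_order all_algebra.
From mathcomp Require Import all_classical all_reals all_analysis.
From mathcomp Require Import ring lra.
Import Order.TTheory GRing.Theory Num.Theory.
Import numFieldNormedType.Exports.
Local Open Scope classical_set_scope.
Local Open Scope ring_scope.

Set Implicit Arguments.
Unset Strict Implicit.
Unset Printing Implicit Defensive.

(** The proof is a Lyapunov argument.  Write dx and dy for the primal and dual
    displacements of one iteration.

    Each block update decreases the objective by at least
    (beta + mu / 2) |dx_i|^2 ([x_descent]).  The dual update increases it, but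
    only by inner products of dy with the previous dual displacement and with the
    change of F(x); and the optimality conditions of two consecutive dual points,
    tested at each other, show that |dy|^2 contracts, with a gain gamma |dy|^2
    from the regularization gamma / 2 |y|^2.  Weighting this contraction by
    4 / (rho gamma) makes the gain a constant multiple of |dy|^2, large enough to
    absorb the dual ascent; the price is a term of order |dx|^2 / gamma^2, which
    half of beta pays for.  The resulting potential ([potential_step]) loses at
    each iteration a multiple of (beta + 1) |dx|^2 + |dy|^2 once the number of
    iterations is large ([x_weight_ge]).

    The potential contains a multiple of ln gamma, which compensates the relative
    decrease of gamma; since 1 / gamma grows at most linearly, the potential is
    bounded below by - A (1 + ln r) ([potential_ge]).  So the losses up to time r
    sum to O(ln r).

    Comparing the variational inequalities of the iterates with those of the
    proximal points in the definition of the gap gives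
    gap^2 <= C ((beta + 1) loss + gamma^2) ([gap_decrease]).  With beta of order
    sqrt r and gamma of order r^(-1/4), up to logarithms, the mean of this bound
    over r in [T, 2 T) is T^(-1/2) up to logarithms ([small_gap]), which is at most
    eps^2 for some T of order eps^-4 up to logarithms ([hitting_step]).

    If some Lipschitz constant Lx i is negative, then the feasible set is a single
    point and the gap vanishes ([gap_eq0]); otherwise every beta r is positive.

    Every optimality condition is used in the form of a variational inequality
    ([argmin_variational]), which needs convexity of the nonsmooth terms but no
    subgradient.  The proximal points exist because a finite convex function on a
    Euclidean space is continuous ([convex_continuous]). *)

(** * Euclidean inner product and norm *)

Section InnerProduct.
Context {R : realType} {n : nat}.
Implicit Types u v w : 'rV[R]_n.

Lemma dotpC u v : dotp u v = dotp v u.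
Proof. by apply: eq_bigr => j _; rewrite mulrC. Qed.

Lemma dotpDl u v w : dotp (u + v) w = dotp u w + dotp v w.
Proof.
by rewrite /dotp -big_split; apply: eq_bigr => j _; rewrite mxE mulrDl.
Qed.

Lemma dotpZl a u w : dotp (a *: u) w = a * dotp u w.
Proof. by rewrite /dotp mulr_sumr; apply: eq_bigr => j _; rewrite mxE mulrA. Qed.

Lemma dotpNl u w : dotp (- u) w = - dotp u w.
Proof. by rewrite -scaleN1r dotpZl mulN1r. Qed.

Lemma dotpBl u v w : dotp (u - v) w = dotp u w - dotp v w.
Proof. by rewrite dotpDl dotpNl. Qed.

Lemma dotpDr u v w : dotp w (u + v) = dotp w u + dotp w v.
Proof. by rewrite !(dotpC w) dotpDl. Qed.

Lemma dotpZr a u w : dotp w (a *: u) = a * dotp w u.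
Proof. by rewrite !(dotpC w) dotpZl. Qed.

Lemma dotpNr u w : dotp w (- u) = - dotp w u.
Proof. by rewrite !(dotpC w) dotpNl. Qed.

Lemma enorm_ge0 m p (A : 'M[R]_(m, p)) : 0 <= enorm A.
Proof. exact: sqrtr_ge0. Qed.

Lemma sqr_enorm m p (A : 'M[R]_(m, p)) :
  enorm A ^+ 2 = \sum_i \sum_j A i j ^+ 2.
Proof.
by rewrite sqr_sqrtr// sumr_ge0// => i _; rewrite sumr_ge0// => j _; rewrite sqr_ge0.
Qed.

Lemma sqr_enorm_rV u : enorm u ^+ 2 = dotp u u.
Proof. by rewrite sqr_enorm big_ord1; apply: eq_bigr => j _; rewrite expr2. Qed.

Definition dotpE := (dotpDl, dotpDr, dotpNl, dotpNr, dotpZl, dotpZr).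

Lemma sqr_enorm_rows m p (A : 'M[R]_(m, p)) :
  enorm A ^+ 2 = \sum_i enorm (row i A) ^+ 2.
Proof.
rewrite sqr_enorm; apply: eq_bigr => i _; rewrite sqr_enorm big_ord1.
by apply: eq_bigr => j _; rewrite mxE.
Qed.

Lemma enorm_row_le m p (A : 'M[R]_(m, p)) i : enorm (row i A) <= enorm A.
Proof.
rewrite -(@ler_pXn2r _ 2)// ?nnegrE ?enorm_ge0// (sqr_enorm_rows A).
rewrite (bigD1 i)//= lerDl; apply: sumr_ge0 => j _; exact: sqr_ge0.
Qed.

Lemma dotp_ge0 u : 0 <= dotp u u.
Proof. by rewrite -sqr_enorm_rV sqr_ge0. Qed.

Lemma enorm0 m p : enorm (0 : 'M[R]_(m, p)) = 0.
Proof.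
rewrite /enorm big1 ?sqrtr0// => i _; rewrite big1// => j _.
by rewrite mxE expr0n.
Qed.

Lemma enormN m p (A : 'M[R]_(m, p)) : enorm (- A) = enorm A.
Proof.
congr Num.sqrt; apply: eq_bigr => i _; apply: eq_bigr => j _.
by rewrite mxE sqrrN.
Qed.

Lemma enorm_sub_sym m p (A B : 'M[R]_(m, p)) : enorm (A - B) = enorm (B - A).
Proof. by rewrite -enormN opprB. Qed.

Lemma enormZ m p a (A : 'M[R]_(m, p)) : enorm (a *: A) = `|a| * enorm A.
Proof.
rewrite /enorm -sqrtr_sqr -sqrtrM ?sqr_ge0//; congr Num.sqrt.
rewrite mulr_sumr; apply: eq_bigr => i _; rewrite mulr_sumr.
by apply: eq_bigr => j _; rewrite mxE exprMn.
Qed.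

Lemma enorm_eq0 m p (A : 'M[R]_(m, p)) : enorm A = 0 -> A = 0.
Proof.
move=> /(congr1 (fun x => x ^+ 2)); rewrite sqr_enorm expr0n/= => /eqP.
rewrite psumr_eq0; last first.
  by move=> i _; rewrite sumr_ge0// => j _; rewrite sqr_ge0.
move=> /allP A0; apply/matrixP => i j; rewrite mxE.
have := A0 i (mem_index_enum _); rewrite implyTb psumr_eq0; last first.
  by move=> k _; rewrite sqr_ge0.
by move=> /allP /(_ j (mem_index_enum _)); rewrite implyTb sqrf_eq0 => /eqP.
Qed.

Lemma dotp_le_enorm u v : dotp u v <= enorm u * enorm v.
Proof.
have [/enorm_eq0 ->|u0] := eqVneq (enorm u) 0.
  by rewrite enorm0 mul0r -(scale0r v) dotpZl mul0r.
have [/enorm_eq0 ->|v0] := eqVneq (enorm v) 0.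
  by rewrite enorm0 mulr0 -(scale0r v) dotpZr mul0r.
have {}u0 : 0 < enorm u by rewrite lt_neqAle eq_sym u0 enorm_ge0.
have {}v0 : 0 < enorm v by rewrite lt_neqAle eq_sym v0 enorm_ge0.
have := dotp_ge0 (enorm v *: u - enorm u *: v).
rewrite !dotpE -!sqr_enorm_rV (dotpC v u).
have uv : 0 < enorm u * enorm v by rewrite mulr_gt0.
move: uv; set a := enorm u; set b := enorm v; set c := dotp u v => uv.
rewrite [X in 0 <= X](_ : _ = 2 * (a * b) * (a * b - c)); last by ring.
by rewrite pmulr_rge0 ?mulr_gt0// subr_ge0.
Qed.

Lemma sqr_enormD u v :
  enorm (u + v) ^+ 2 = enorm u ^+ 2 + 2 * dotp u v + enorm v ^+ 2.
Proof. by rewrite !sqr_enorm_rV !dotpE (dotpC v u); ring. Qed.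

End InnerProduct.

Section ProductNorm.
Context {R : realType} {m n p q : nat}.
Implicit Types z : 'M[R]_(m, n) * 'M[R]_(p, q).

Lemma sqr_enorm2 z : enorm2 z ^+ 2 = enorm z.1 ^+ 2 + enorm z.2 ^+ 2.
Proof. by rewrite sqr_sqrtr// addr_ge0 ?sqr_ge0. Qed.

Lemma enorm2_ge0 z : 0 <= enorm2 z.
Proof. exact: sqrtr_ge0. Qed.

Lemma enorm2_leD z : enorm2 z <= enorm z.1 + enorm z.2.
Proof.
have a := enorm_ge0 z.1; have b := enorm_ge0 z.2.
rewrite -(@ler_pXn2r _ 2)// ?nnegrE ?enorm2_ge0 ?addr_ge0//.
by rewrite sqr_enorm2; nra.
Qed.

Lemma enorm2_eq0 z : enorm2 z = 0 -> z = 0.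
Proof.
move=> /(congr1 (fun x => x ^+ 2)); rewrite sqr_enorm2 expr0n/= => /eqP.
rewrite paddr_eq0 ?sqr_ge0// !sqrf_eq0 => /andP[/eqP/enorm_eq0 z1 /eqP/enorm_eq0 z2].
by rewrite (surjective_pairing z) z1 z2.
Qed.

End ProductNorm.

(** * Convex sets and functions *)

Section Convexity.
Context {R : realType} {n : nat}.
Implicit Types (X : set 'rV[R]_n) (phi : 'rV[R]_n -> R).

Lemma segment_point (u v : 'rV[R]_n) (t : R) :
  t *: v + (1 - t) *: u = u + t *: (v - u).
Proof. by apply/rowP => j; rewrite !mxE; ring. Qed.

Lemma convex_setE X : convex_set X ->
  forall u v t, X u -> X v -> 0 <= t -> t <= 1 -> X (u + t *: (v - u)).
Proof.
move=> cX u v t Xu Xv t0 t1; rewrite -segment_point.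
by have := cX v u (Itv01 t0 t1); rewrite !inE; apply.
Qed.

Lemma convex_functionE phi : convex_function setT phi ->
  forall u v t, 0 <= t -> t <= 1 ->
  phi (u + t *: (v - u)) <= phi u + t * (phi v - phi u).
Proof.
move=> cphi u v t t0 t1; rewrite -segment_point.
have := cphi (Itv01 t0 t1) v u; rewrite !inE => /(_ I I).
by rewrite convRE /= => /le_trans; apply; rewrite /unstable.onem; lra.
Qed.

Lemma convex_functionI phi :
  (forall u v t, 0 <= t -> t <= 1 ->
    phi (u + t *: (v - u)) <= phi u + t * (phi v - phi u)) ->
  convex_function setT phi.
Proof.
move=> cphi t v u _ _.
have := cphi u v t%:num; rewrite -segment_point => /(_ _ _)/le_trans; apply => //.
by rewrite convRE /unstable.onem; lra.
Qed.

Lemma convex_functionD phi psi : convex_function setT phi ->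
  convex_function setT psi -> convex_function setT (fun u => phi u + psi u).
Proof.
move=> /convex_functionE cphi /convex_functionE cpsi.
apply: convex_functionI => u v t t0 t1.
by have := cphi u v t t0 t1; have := cpsi u v t t0 t1; lra.
Qed.

Lemma sqr_enorm_segment (u v w : 'rV[R]_n) t :
  enorm (u + t *: (v - u) - w) ^+ 2 =
  enorm (u - w) ^+ 2 + t * (2 * dotp (u - w) (v - u)) + t ^+ 2 * enorm (v - u) ^+ 2.
Proof.
rewrite addrAC (sqr_enormD (u - w)) dotpZr enormZ exprMn real_normK ?num_real//.
by ring.
Qed.

Lemma convex_sqr_enorm b (w : 'rV[R]_n) : 0 <= b ->
  convex_function setT (fun u => b * enorm (u - w) ^+ 2).
Proof.
move=> b0; apply: convex_functionI => u v t t0 t1.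
rewrite sqr_enorm_segment.
have -> : enorm (v - w) ^+ 2 = enorm (u + 1 *: (v - u) - w) ^+ 2.
  by rewrite scale1r [u + _]addrC subrK.
rewrite sqr_enorm_segment -subr_ge0.
set a := enorm (v - u); set c := dotp _ _.
rewrite [X in 0 <= X](_ : _ = b * (t * (1 - t)) * a ^+ 2); last by ring.
have t10 : 0 <= 1 - t by rewrite subr_ge0.
by rewrite mulr_ge0 ?sqr_ge0// mulr_ge0// mulr_ge0.
Qed.

End Convexity.

(** * Continuity of convex functions *)

Section ConvexContinuity.
Context {R : realType} {n : nat}.
Implicit Types (X : set 'rV[R]_n) (phi : 'rV[R]_n -> R).

(** On a coordinate line the chords from x to the points at distance 1 bound the
    increment linearly.  A sum of two displacements is the midpoint of their
    doubles, so by convexity the bound passes to sums, at the price of halving the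
    admissible size d. *)
Lemma convex_increment_le phi (x : 'rV[R]_n) (s : seq 'I_n) :
  convex_function setT phi ->
  exists2 C : R, 0 <= C & exists2 d : R, 0 < d & forall (a : 'I_n -> R) (t : R),
    (forall j, `|a j| <= t) -> t <= d ->
    phi (x + \sum_(j <- s) a j *: delta_mx 0 j) - phi x <= C * t.
Proof.
move=> /convex_functionE cphi; elim: s => [|j s [C C0 [d d0 IH]]].
  exists 0 => //; exists 1 => // a t _ _.
  by rewrite big_nil addr0 subrr mul0r.
pose e : 'rV[R]_n := delta_mx 0 j.
pose m := `|phi (x + e) - phi x| + `|phi (x - e) - phi x|.
exists (C + m); first by rewrite addr_ge0// addr_ge0.
exists (Num.min (d / 2) 2^-1); first by rewrite lt_min !divr_gt0//= invr_gt0.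
move=> a t at_ tle.
have t0 : 0 <= t := le_trans (normr_ge0 _) (at_ j).
have [td t1] : t <= d / 2 /\ t <= 2^-1 by apply/andP; rewrite -le_min.
have line b : 0 <= b -> b <= t -> forall v,
    phi (x + (2 * b) *: v) - phi x <= 2 * t * `|phi (x + v) - phi x|.
  move=> b0 bt v.
  have := cphi x (x + v) (2 * b); rewrite addrAC subrr add0r => H.
  have {H} : phi (x + (2 * b) *: v) <= phi x + 2 * b * (phi (x + v) - phi x).
    by apply: H; lra.
  have := ler_norm (phi (x + v) - phi x).
  have := normr_ge0 (phi (x + v) - phi x).
  move: (phi _ - _) `|_| => p q q0 pq H.
  rewrite lerBlDl (le_trans H)// lerD2l.
  apply: (@le_trans _ _ (2 * b * q)); first by rewrite ler_wpM2l// mulr_ge0.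
  by rewrite ler_wpM2r// ler_pM2l.
have linej : phi (x + (2 * a j) *: e) - phi x <= 2 * t * m.
  have le_m p q : 0 <= p -> 0 <= q -> 2 * t * p <= 2 * t * (p + q) /\
      2 * t * q <= 2 * t * (p + q).
    by move=> p0 q0; split; rewrite ler_wpM2l ?mulr_ge0// (lerDl, lerDr).
  have [m1 m2] := le_m _ _ (normr_ge0 (phi (x + e) - phi x))
    (normr_ge0 (phi (x - e) - phi x)).
  have [aj0|aj0] := leP 0 (a j).
    apply: le_trans m1; apply: line => //.
    exact: le_trans (ler_norm _) (at_ j).
  apply: le_trans m2; rewrite -[2 * a j]opprK scaleNr -scalerN -mulrN.
  apply: line; first by rewrite oppr_ge0 ltW.
  by apply: le_trans (at_ j); rewrite ltr0_norm.
have {}IH : phi (x + \sum_(k <- s) (2 * a k) *: delta_mx 0 k) - phi x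
    <= C * (2 * t).
  apply: (IH (fun k => 2 * a k)) => [k|]; last by lra.
  by rewrite normrM ger0_norm// ler_pM2l.
have := cphi (x + (2 * a j) *: e) (x + \sum_(k <- s) (2 * a k) *: delta_mx 0 k) 2^-1.
rewrite [X in phi X](_ : _ = x + \sum_(k <- j :: s) a k *: delta_mx 0 k); last first.
  rewrite big_cons -/e (eq_bigr (fun k => 2 *: (a k *: delta_mx 0 k))); last first.
    by move=> k _; rewrite scalerA.
  rewrite -scaler_sumr; move: (\sum_(_ <- _) _) => S.
  by apply/rowP => k; rewrite !mxE; field.
by move=> H; have := H ltac:(by rewrite invr_ge0) ltac:(lra); lra.
Qed.

(** Every finite convex function on a Euclidean space is continuous: it grows
    at most linearly around each point, and reflecting a displacement through
    the point turns that upper bound into a lower one. *)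
Lemma convex_continuous phi : convex_function setT phi ->
  continuous (phi : 'rV[R]_n -> R).
Proof.
move=> cphi x; have [C C0 [d d0 H]] := convex_increment_le x (index_enum _) cphi.
have {}H (u : 'rV[R]_n) (t : R) : (forall j, `|u 0 j| <= t) ->
    t <= d -> phi (x + u) - phi x <= C * t.
  by rewrite {2}(row_sum_delta u); exact: H.
apply/(@cvgrPdist_le _ _ _ (nbhs x) (nbhs_filter x)) => eps eps0.
pose t := Num.min d (eps / (C + 1)).
have C10 : 0 < C + 1 by rewrite ltr_pwDr.
have t0 : 0 < t by rewrite lt_min d0 divr_gt0.
have Ct : C * t <= eps.
  apply: (@le_trans _ _ ((C + 1) * (eps / (C + 1)))); last first.
    by rewrite mulrCA divff ?mulr1// gt_eqF.
  by apply: ler_pM => //; [exact: ltW|rewrite lerDl|rewrite ge_min lexx orbT].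
near=> u.
have xu j : `|x 0 j - u 0 j| <= t.
  have : ball x t u by near: u; exact: nbhsx_ballx.
  by case=> _ /(_ 0 j)/ltW.
have td : t <= d by rewrite ge_min lexx.
have u1 : phi (x + (u - x)) - phi x <= C * t.
  by apply: H => // j; rewrite !mxE distrC.
have u2 : phi (x + (x - u)) - phi x <= C * t by apply: H => // j; rewrite !mxE.
have /convex_functionE/(_ (x + (x - u)) u 2^-1) := cphi.
rewrite [X in phi X <= _](_ : _ = x); last by apply/rowP => j; rewrite !mxE; field.
move=> H2; have {}H2 := H2 ltac:(by rewrite invr_ge0) ltac:(lra).
rewrite [x + (u - x)]addrC subrK in u1.
by rewrite ler_norml; apply/andP; split; lra.
Unshelve. all: by end_near.
Qed.

Lemma exists_argmin_convex X phi : compact X -> X !=set0 ->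
  convex_function setT phi -> exists u, is_argmin X phi u.
Proof.
move=> cX X0 /convex_continuous cphi.
have [c] := EVT_min_rV X0 cX (continuous_subspaceT cphi).
rewrite inE => Xc cmin; exists c; split=> // v Xv.
by apply: cmin; rewrite inE.
Qed.

Lemma compact_sqr_enorm_bounded X : compact X ->
  exists2 D : R, 0 <= D & forall u, X u -> enorm u ^+ 2 <= D.
Proof.
move=> cX; have [[x Xx]|X0] := pselect (X !=set0); last first.
  by exists 0 => // u Xu; case: X0; exists u.
have cphi : continuous ((fun u => 1 * enorm (u - 0) ^+ 2) : 'rV[R]_n -> R).
  by apply: convex_continuous; apply: convex_sqr_enorm.
have [c _ cmax] := EVT_max_rV (ex_intro _ x Xx) cX (continuous_subspaceT cphi).
exists (enorm c ^+ 2); first exact: sqr_ge0.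
by move=> u Xu; have := cmax u; rewrite inE !mul1r !subr0; apply.
Qed.

End ConvexContinuity.

(** * First-order optimality *)

Lemma ge0_of_small_quadratic (R : realType) (a c : R) :
  (forall t, 0 < t -> t <= 1 -> 0 <= t * a + t ^+ 2 * c) -> 0 <= a.
Proof.
move=> H; rewrite leNgt; apply/negP => a0.
pose t := Num.min 1 (- a / (2 * (`|c| + 1))).
have c1 : 0 < `|c| + 1 by rewrite ltr_pwDr.
have t0 : 0 < t by rewrite lt_min ltr01 divr_gt0 ?oppr_gt0// mulr_gt0.
have tc : t * (`|c| + 1) <= - a / 2.
  rewrite -ler_pdivlMr// (le_trans (_ : t <= - a / (2 * (`|c| + 1))))//.
    by rewrite ge_min lexx orbT.
  by rewrite invfM mulrA.
have := H t t0; rewrite ge_min lexx => /(_ isT).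
rewrite expr2 -mulrA -mulrDr pmulr_rge0// => H2.
have := ler_norm c; have := ltW t0; nra.
Qed.

Section VariationalInequality.
Context {R : realType} {n : nat}.
Implicit Types (X : set 'rV[R]_n).

(** Moving from the minimizer u towards v by a step t changes h by at most
    t (h v - h u), by convexity, and phi by at most t <p, v - u> up to O(t^2); the
    total change is nonnegative for all small t.  Only an upper expansion of phi
    along segments of X is required, so that p can be the gradient of a function
    that is controlled on X alone. *)
Lemma argmin_variational X (h phi : 'rV[R]_n -> R) (p u : 'rV[R]_n) :
  convex_set X -> convex_function setT h ->
  (forall v, X v -> exists c, forall t, 0 < t -> t <= 1 ->
     phi (u + t *: (v - u)) <= phi u + t * dotp p (v - u) + t ^+ 2 * c) ->
  is_argmin X (fun v => phi v + h v) u ->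
  forall v, X v -> 0 <= dotp p (v - u) + h v - h u.
Proof.
move=> cX /convex_functionE ch Hphi [Xu umin] v Xv; have [c Hc] := Hphi v Xv.
apply: (@ge0_of_small_quadratic _ _ c) => t t0 t1.
have := umin _ (convex_setE cX Xu Xv (ltW t0) t1).
by have := Hc t t0 t1; have := ch u v t (ltW t0) t1; lra.
Qed.

Lemma prox_variational X h b (w u : 'rV[R]_n) :
  convex_set X -> convex_function setT h ->
  is_argmin X (fun v => h v + b / 2 * enorm (v - w) ^+ 2) u ->
  forall v, X v -> 0 <= dotp (b *: (u - w)) (v - u) + h v - h u.
Proof.
move=> cX ch umin.
apply: (@argmin_variational _ _ (fun v => b / 2 * enorm (v - w) ^+ 2)) => //.
  move=> v _; exists (b / 2 * enorm (v - u) ^+ 2) => t _ _.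
  by rewrite sqr_enorm_segment dotpZl; rewrite le_eqVlt; apply/orP; left; apply/eqP; field.
by case: umin => Xu umin; split=> // v /umin; rewrite addrC [X in _ <= X]addrC.
Qed.

End VariationalInequality.

(** * The potential inequality in scalar form *)

Lemma ler_cancel_sqr (R : realType) (a b c : R) :
  0 <= a -> 0 <= c -> b * a ^+ 2 <= c * a -> b * a <= c.
Proof.
move=> a0 c0; have [->|an0] := eqVneq a 0; first by rewrite !mulr0.
have {an0}a0 : 0 < a by rewrite lt_neqAle eq_sym an0.
by rewrite expr2 mulrA ler_pM2r.
Qed.

(** With t = b / a, this is t - 1 <= B ln t, which follows from
    1 - 1 / t <= ln t on [1, B]. *)
Lemma relative_decrease_le_ln (R : realType) (a b B : R) :
  0 < a -> a <= b -> b / a <= B -> (b - a) / a <= B * (ln b - ln a).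
Proof.
move=> a0 ab baB.
have b0 : 0 < b := lt_le_trans a0 ab.
have H : ln a - ln b <= a / b - 1.
  rewrite -ln_div ?posrE//.
  have := @le_ln1Dx R (a / b - 1); rewrite subrKC; apply.
  by rewrite ltrBrDl subrr divr_gt0.
have ab0 : 0 <= (b - a) / b by rewrite divr_ge0 ?subr_ge0// ltW.
have -> : (b - a) / a = b / a * ((b - a) / b).
  by field; rewrite !gt_eqF.
have {}H : (b - a) / b <= ln b - ln a.
  by rewrite mulrBl divff ?gt_eqF//; lra.
by apply: ler_pM => //; rewrite divr_ge0// ltW.
Qed.

(** Here y1, y2 are consecutive dual iterates with parameters gam', gam,
    D = y2 - y1, dl is the dual displacement before D, and F1, F2 are the values
    of F used by the two updates.  The scalars stand for d = |x2 - x1|, e = |D|,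
    dl2 = |dl|^2, s = <dl, D>, q = <y1, D>, n1 = |y1|^2, F2D = <F2, D> and
    c = <F2 - F1, D>; the objective takes the values obj1 at (x1, y1), obj21 at
    (x2, y1) and obj2 at (x2, y2).  The two hypotheses that
    involve both q and F2D are the optimality conditions of y1 and y2, tested at
    each other. *)
Lemma potential_step_arith (R : realType)
    (rho gam gam' L d e dl2 s q n1 Dm B c g1 g2 F2D obj1 obj21 obj2 cx : R) :
  0 < rho -> 0 < gam -> gam <= gam' -> gam' / gam <= B ->
  gam^-1 - gam'^-1 <= rho / 5 ->
  0 <= dl2 -> s <= (dl2 + e ^+ 2) / 2 ->
  0 <= n1 -> 0 <= n1 + 2 * q + e ^+ 2 -> n1 + 2 * q + e ^+ 2 <= Dm ->
  c <= L * d * e ->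
  0 <= rho^-1 * s + gam' * q - (F2D - c) + g2 - g1 ->
  0 <= - (rho^-1 * e ^+ 2 + gam * (q + e ^+ 2) - F2D) + g1 - g2 ->
  obj21 + cx * d ^+ 2 <= obj1 -> obj2 = obj21 + F2D - g2 + g1 ->
  obj2 + (2 / (rho ^+ 2 * gam) + 9 / 10 / rho) * e ^+ 2
    + 2 * Dm * B / rho * ln gam + gam * (Dm - (n1 + 2 * q + e ^+ 2)) / 2
    + (cx - 2 * L ^+ 2 / (rho * gam ^+ 2) - rho * L ^+ 2) * d ^+ 2
    + 7 / 20 / rho * e ^+ 2
  <= obj1 + (2 / (rho ^+ 2 * gam') + 9 / 10 / rho) * dl2
    + 2 * Dm * B / rho * ln gam' + gam' * (Dm - n1) / 2.
Proof.
move=> rho0 gam0 gg' g'B inv dl0 sle n10 n20 n2D cle V1 V2 desc ->.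
have gam'0 : 0 < gam' := lt_le_trans gam0 gg'.
have Dm0 : 0 <= Dm := le_trans n20 n2D.
have e20 := sqr_ge0 e.
have lnB := relative_decrease_le_ln gam0 gg' g'B.
have -> : 2 / (rho ^+ 2 * gam) = 2 * (rho^-1 ^+ 2 * gam^-1).
  by rewrite invfM exprVn.
have -> : 2 / (rho ^+ 2 * gam') = 2 * (rho^-1 ^+ 2 * gam'^-1).
  by rewrite invfM exprVn.
have -> : 2 * L ^+ 2 / (rho * gam ^+ 2) = 2 * L ^+ 2 * (rho^-1 * gam^-1 ^+ 2).
  by rewrite invfM exprVn.
have Gg : gam^-1 * gam = 1 by rewrite mulVf// gt_eqF.
have ir : rho^-1 * rho = 1 by rewrite mulVf// gt_eqF.
have i0 : 0 < rho^-1 by rewrite invr_gt0.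
have G0 : 0 < gam^-1 by rewrite invr_gt0.
move: i0 G0 Gg ir lnB inv V1 V2.
set i := rho^-1; set G := gam^-1; set G' := gam'^-1 => i0 G0 Gg ir lnB inv V1 V2.
(* The sum of the two optimality conditions: the contraction of |D|^2. *)
have sum : 0 <= i * (dl2 - e ^+ 2) / 2 + L * d * e - gam * e ^+ 2
    + (gam' - gam) * Dm / 2.
  have h1 : i * s <= i * ((dl2 + e ^+ 2) / 2) by rewrite ler_wpM2l// ltW.
  have h2 : (gam' - gam) * q <= (gam' - gam) * (Dm / 2).
    by rewrite ler_wpM2l ?subr_ge0//; lra.
  lra.
(* Multiplied by 4 / (rho gam), the gain gam |D|^2 becomes 4 |D|^2 / rho. *)
have scaled : 0 <= 2 * (i ^+ 2 * G) * (dl2 - e ^+ 2) + 4 * (i * G) * (L * d * e)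
    - 4 * i * e ^+ 2 + 2 * i * Dm * ((gam' - gam) * G).
  have iG : 0 <= 4 * (i * G) by rewrite mulr_ge0// mulr_ge0// ltW.
  have := mulr_ge0 iG sum; congr (0 <= _).
  have -> : 4 * i * e ^+ 2 = 4 * i * e ^+ 2 * (G * gam) by rewrite Gg mulr1.
  by field.
have k1 : 2 * i * Dm * ((gam' - gam) * G) <= 2 * i * Dm * (B * (ln gam' - ln gam)).
  by rewrite ler_wpM2l// mulr_ge0// mulr_ge0// ltW.
(* The weight of |dl|^2 increases with 1 / gam, by a controlled amount. *)
have k2 : 2 * (i ^+ 2 * G) * dl2 <= 2 * (i ^+ 2 * G') * dl2 + 2 / 5 * i * dl2.
  have : (2 * i ^+ 2 * dl2) * (G - G') <= (2 * i ^+ 2 * dl2) * (rho / 5).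
    by rewrite ler_wpM2l// mulr_ge0// mulr_ge0// sqr_ge0.
  have -> : 2 * i ^+ 2 * dl2 * (rho / 5) = 2 / 5 * i * dl2 * (i * rho) by field.
  by rewrite ir; lra.
(* Young inequalities for both occurrences of the coupling L d e: they spend
   9 / (4 rho) of the coefficient of |D|^2. *)
have k3 : 4 * (i * G) * (L * d * e) <= 2 * i * e ^+ 2 + 2 * L ^+ 2 * (i * G ^+ 2) * d ^+ 2.
  have : 0 <= 2 * i * (e - L * d * G) ^+ 2.
    by rewrite mulr_ge0 ?sqr_ge0// mulr_ge0// ltW.
  by lra.
have k4 : L * d * e <= i / 4 * e ^+ 2 + rho * L ^+ 2 * d ^+ 2.
  have : 0 <= i / 4 * (e - 2 * rho * L * d) ^+ 2.
    by rewrite mulr_ge0 ?sqr_ge0// divr_ge0// ltW.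
  have -> : i / 4 * (e - 2 * rho * L * d) ^+ 2 = i / 4 * e ^+ 2
     - (i * rho) * (L * d * e) + (i * rho) * (rho * L ^+ 2 * d ^+ 2) by field.
  by rewrite ir; lra.
(* The variation of gam |y|^2 / 2 telescopes, up to the decrease of gam. *)
have k5 : 0 <= (gam' - gam) * (Dm - (n1 + 2 * q + e ^+ 2)).
  by rewrite mulr_ge0// subr_ge0.
have k6 : 0 <= gam' * e ^+ 2 by rewrite mulr_ge0// ltW.
have k7 : i * s <= i * ((dl2 + e ^+ 2) / 2) by rewrite ler_wpM2l// ltW.
have k8 : 0 <= i * e ^+ 2 by rewrite mulr_ge0// ltW.
lra.
Qed.

(** * One iteration of the algorithm *)

Section MinModulus.
Context {R : realType} {K : nat}.

Lemma min_modulus_le (mu : 'I_K.+1 -> R) i : min_modulus mu <= mu i.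
Proof. exact: bigmin_le_cond. Qed.

Lemma min_modulus_gt0 (mu : 'I_K.+1 -> R) :
  (forall i, 0 < mu i) -> 0 < min_modulus mu.
Proof. by move=> mu0; apply/bigmin_gtP. Qed.

End MinModulus.

Lemma grady_linear (R : realType) (K N M : nat)
    (f : 'M[R]_(K.+1, N) * 'rV[R]_M -> R) (F : 'M[R]_(K.+1, N) -> 'rV[R]_M) z :
  assumptionC4 f F -> grady f z = F z.1.
Proof.
move=> hC4; apply/rowP => j; rewrite mxE.
apply: cvg_lim => //; apply: cvg_near_cst.
near=> t.
have t0 : t != 0 by near: t; exact: nbhs_dnbhs_neq.
rewrite /= -!/(_ *: _) !hC4 dotpDl dotpZl addrK.
have -> : dotp (delta_mx 0 j) (F z.1) = F z.1 0 j.
  rewrite /dotp (bigD1 j)//= big1 ?addr0 => [|k /negbTE kj].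
    by rewrite mxE !eqxx mul1r.
  by rewrite mxE kj andbF mul0r.
by rewrite /GRing.scale /= mulKf.
Unshelve. all: by end_near.
Qed.

Section HiBSA.
Context {R : realType} {K N M : nat}.
Context {f : 'M[R]_(K.+1, N) * 'rV[R]_M -> R}.
Context {h : 'I_K.+1 -> 'rV[R]_N -> R} {g : 'rV[R]_M -> R}.
Context {X : 'I_K.+1 -> set 'rV[R]_N} {Y : set 'rV[R]_M}.
Context {U : 'I_K.+1 -> 'rV[R]_N -> 'M[R]_(K.+1, N) -> 'rV[R]_M -> R}.
Context {F : 'M[R]_(K.+1, N) -> 'rV[R]_M}.
Context {Lx mu Lu : 'I_K.+1 -> R} {Ly rho : R}.
Context {gamma beta : nat -> R}.
Context {xs : nat -> 'M[R]_(K.+1, N)} {ys : nat -> 'rV[R]_M}.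
Context (hA : assumptionA f h g X Y Lx Ly) (hB : assumptionB f X Y U mu Lu).
Context (hrho : 0 < rho) (hC3 : assumptionC3 rho Ly Lx mu gamma beta).
Context (hC4 : assumptionC4 f F).
Context (halg : HiBSA f h g X Y U rho gamma beta xs ys).

Lemma xs_feasible r : (1 <= r)%N -> prodX X (xs r).
Proof.
case: r => [//|[_|r _]]; first exact: HiBSA_x1 halg.
by move=> i; case: (HiBSA_x halg i (isT : (1 <= r.+1)%N)).
Qed.

Lemma ys_feasible r : (1 <= r)%N -> Y (ys r).
Proof.
case: r => [//|[_|r _]]; first exact: HiBSA_y1 halg.
by case: (HiBSA_y halg (isT : (1 <= r.+1)%N)).
Qed.

Lemma splice_feasible i (x' x : 'M[R]_(K.+1, N)) :
  prodX X x' -> prodX X x -> prodX X (splice i x' x).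
Proof.
move=> Xx' Xx k; rewrite (_ : row k _ = if (k < i)%N then row k x' else row k x).
  by case: ifP.
by apply/rowP => j; rewrite !mxE; case: ifP; rewrite mxE.
Qed.

Lemma row_splice i (x' x : 'M[R]_(K.+1, N)) : row i (splice i x' x) = row i x.
Proof. by apply/rowP => j; rewrite !mxE ltnn. Qed.

Lemma F_lipschitz x x' : prodX X x -> prodX X x' ->
  enorm (F x' - F x) <= `|Ly| * enorm (x' - x).
Proof.
move=> Xx Xx'; have Yy := HiBSA_y1 halg.
have := A3_grady_lipschitz hA (z := (x, ys 1)) (z' := (x', ys 1)).
move=> /(_ (conj Xx Yy) (conj Xx' Yy)).
rewrite !(grady_linear _ hC4) /= => /le_trans; apply.
apply: (@le_trans _ _ (`|Ly| * enorm2 ((x', ys 1) - (x, ys 1)))).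
  by rewrite ler_wpM2r ?enorm2_ge0 ?ler_norm.
rewrite ler_wpM2l// (le_trans (enorm2_leD _))//=.
by rewrite subrr enorm0 addr0.
Qed.

Lemma y_variational r u : (1 <= r)%N -> Y u ->
  0 <= dotp (rho^-1 *: (ys r.+1 - ys r) + gamma r *: ys r.+1 - F (xs r.+1))
         (u - ys r.+1) + g u - g (ys r.+1).
Proof.
move=> r1; move: u; have := HiBSA_y halg r1 => -[Yy ymax].
pose phi v := - Uy f rho v (xs r.+1) (ys r) + gamma r / 2 * enorm v ^+ 2.
apply: (@argmin_variational _ _ _ _ phi).
- exact: A1_Y_convex hA.
- exact: A2_g_convex hA.
- move=> v _; set d := v - _.
  exists (((2 * rho)^-1 + gamma r / 2) * enorm d ^+ 2) => t _ _.
  rewrite /phi /Uy !hC4 sqr_enorm_segment.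
  have := sqr_enorm_segment (ys r.+1) v 0 t; rewrite !subr0 => ->.
  rewrite -/d; clearbody d.
  rewrite le_eqVlt; apply/orP; left; apply/eqP.
  rewrite !(dotpBl, dotpDl, dotpZl) (dotpC (F _) d).
  by field; exact: lt0r_neq0.
- by split=> // v /ymax; rewrite /phi; lra.
Qed.

(** The first-order upper expansion of U_i comes from its strong convexity at
    the moved point and the Lipschitz continuity of its gradient on X_i. *)
Lemma x_variational r i v : (1 <= r)%N -> X i v ->
  0 <= dotp (grad (fun t => U i t (splice i (xs r.+1) (xs r)) (ys r)) (row i (xs r.+1))
             + beta r *: (row i (xs r.+1) - row i (xs r))) (v - row i (xs r.+1))
       + h i v - h i (row i (xs r.+1)).
Proof.
move=> r1; move: v; have := HiBSA_x halg i r1.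
set w := splice _ _ _; set u := row i (xs r.+1) => -[Xu umin].
have Xw : prodX X w by apply: splice_feasible; exact: xs_feasible.
have Yy := ys_feasible r1.
pose phi v := U i v w (ys r) + beta r / 2 * enorm (v - row i (xs r)) ^+ 2.
apply: (@argmin_variational _ _ _ _ phi).
- exact: A1_X_convex hA i.
- exact: A2_h_convex hA i.
- move=> v Xv.
  exists ((`|Lu i| + beta r / 2) * enorm (v - u) ^+ 2) => t t0 t1.
  rewrite /phi sqr_enorm_segment.
  have Xt : X i (u + t *: (v - u)) by apply: convex_setE (ltW t0) t1; first exact: A1_X_convex hA i.
  have H1 := B1_strongly_convex hB Xw Yy Xu Xt.
  have H2 := B4_lipschitz hB Xw Yy Xu Xt.
  have H3 := dotp_le_enorm (grad (fun t => U i t w (ys r)) (u + t *: (v - u)) -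
    grad (fun t => U i t w (ys r)) u) (v - u).
  move: H1 H2 H3; set gt := grad _ _; set gu := grad _ _ => H1 H2 H3.
  rewrite opprD addNKr in H1.
  rewrite opprD addNKr enormN enormZ (ger0_norm (ltW t0)) in H2.
  have mu0 := B1_modulus hB i.
  have e0 := enorm_ge0 (v - u).
  have L0 := ler_norm (Lu i).
  rewrite dotpNr dotpZr enormN enormZ (ger0_norm (ltW t0)) in H1.
  rewrite dotpBl in H3; rewrite (dotpDl gu) dotpZl.
  move: H1 H2 H3 e0; set a := dotp gt _; set b := dotp gu _.
  set e := enorm (v - u); set G := enorm (gt - gu); set V := U i (u + _) w _.
  move=> H1 H2 H3 e0.
  have {}H2 : G * e <= `|Lu i| * (t * e) * e.
    rewrite ler_wpM2r// (le_trans H2)// ler_wpM2r// mulr_ge0//; exact: ltW.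
  have {}H1 : V <= U i u w (ys r) + t * a.
    have : 0 <= mu i / 2 * (t * e) ^+ 2 by rewrite mulr_ge0 ?sqr_ge0 ?divr_ge0// ltW.
    by lra.
  have {H2 H3} : t * a <= t * (b + `|Lu i| * (t * e) * e).
    by rewrite ler_wpM2l ?(ltW t0)//; lra.
  by set q := dotp _ (v - u); set q2 := enorm _; lra.
- split=> // v /umin; rewrite /phi; lra.
Qed.

(** The blocks updated so far form a chain of splices from x^r to x^(r+1).  Along
    each link U_i majorizes f and agrees with it at the old block, so the decrease
    of f + h_i is at least that of the strongly convex subproblem. *)
Lemma x_descent r : (1 <= r)%N ->
  f (xs r.+1, ys r) + \sum_i h i (row i (xs r.+1)) +
    (beta r + min_modulus mu / 2) * enorm (xs r.+1 - xs r) ^+ 2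
  <= f (xs r, ys r) + \sum_i h i (row i (xs r)).
Proof.
move=> r1; have Yy := ys_feasible r1.
pose x' := xs r.+1; pose x := xs r.
pose spl k : 'M[R]_(K.+1, N) := \matrix_(l, j) (if (l < k)%N then x' l j else x l j).
have step (i : 'I_K.+1) : f (spl i.+1, ys r) - f (spl i, ys r) +
    (h i (row i x') - h i (row i x)) +
    (beta r + min_modulus mu / 2) * enorm (row i (x' - x)) ^+ 2 <= 0.
  have Xw : prodX X (splice i x' x) by apply: splice_feasible; exact: xs_feasible.
  have Xx' : X i (row i x') by exact: xs_feasible.
  have Xx : X i (row i x) by exact: xs_feasible.
  have := x_variational r1 Xx; rewrite -/x -/x'.
  have := B1_strongly_convex hB Xw Yy Xx Xx'.
  have := B3_upper_bound hB Xw Yy Xx'.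
  have := B3_tight hB i Xw Yy; rewrite row_splice => ->.
  have -> : subst_block (splice i x' x) i (row i x') = spl i.+1.
    apply/matrixP => k j; rewrite !mxE; have [->|ki] := eqVneq k i.
      by rewrite ltnS leqnn.
    by rewrite ltnS; case: ltngtP => // /val_inj ik; rewrite ik eqxx in ki.
  have -> : splice i x' x = spl i by [].
  rewrite dotpDl dotpZl -(opprB (row i x')) !dotpNr enormN -sqr_enorm_rV.
  have -> : row i (x' - x) = row i x' - row i x by apply/rowP => j; rewrite !mxE.
  have := min_modulus_le mu i; have := sqr_ge0 (enorm (row i x' - row i x)).
  set e := enorm _ ^+ 2; set G := dotp _ _; set m := min_modulus mu => e0 mi.
  have : m * e <= mu i * e by rewrite ler_wpM2r.
  lra.
have tele : f (x', ys r) - f (x, ys r) =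
    \sum_(i < K.+1) (f (spl i.+1, ys r) - f (spl i, ys r)).
  rewrite -(big_mkord xpredT (fun i => f (spl i.+1, ys r) - f (spl i, ys r))).
  rewrite telescope_sumr//; congr (f (_, _) - f (_, _)); apply/matrixP => k j.
    by rewrite mxE ltn_ord.
  by rewrite mxE.
have : \sum_(i < K.+1) (f (spl i.+1, ys r) - f (spl i, ys r) +
    (h i (row i x') - h i (row i x)) +
    (beta r + min_modulus mu / 2) * enorm (row i (x' - x)) ^+ 2) <= 0.
  by apply: sumr_le0 => i _; exact: step.
rewrite big_split /= big_split /= -tele -mulr_sumr -sqr_enorm_rows sumrB -/x -/x'.
lra.
Qed.

(** * Decrease of the potential *)

Lemma gamma_nonincreasing r : (1 <= r)%N -> gamma r.+1 <= gamma r.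
Proof. by move=> r1; rewrite -subr_ge0; exact: C3_decreasing hC3 _ r1. Qed.

Lemma gamma_le1 r : (1 <= r)%N -> gamma r <= gamma 1.
Proof.
elim: r => // -[_ _ //|r IH _].
by apply: le_trans (IH isT); exact: gamma_nonincreasing.
Qed.

Lemma gamma_inv_le r : (1 <= r)%N -> (gamma r)^-1 <= (gamma 1)^-1 + rho / 5 * r%:R.
Proof.
have r5 : 0 <= rho / 5 by rewrite divr_ge0// ltW.
elim: r => // -[_ _|r IH _].
  by rewrite lerDl mulr1.
have := IH isT; have := C3_inverse hC3 (isT : (1 <= r.+1)%N).
by rewrite -[r.+2%:R]natr1 mulrDr mulr1; move: (_ * _) => p; lra.
Qed.

Lemma gamma_ratio_le r : (1 <= r)%N ->
  gamma r / gamma r.+1 <= 1 + gamma 1 * (rho / 5).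
Proof.
move=> r1; have g0 := C3_positive hC3 r1.
have := C3_inverse hC3 r1; have := gamma_le1 r1.
have r5 : 0 <= rho / 5 by rewrite divr_ge0// ltW.
move=> g1 inv; have : gamma r * ((gamma r.+1)^-1 - (gamma r)^-1) <= gamma 1 * (rho / 5).
  apply: (@le_trans _ _ (gamma r * (rho / 5))).
    by rewrite ler_wpM2l// ltW.
  by rewrite ler_wpM2r.
by rewrite mulrBr divff ?gt_eqF//; lra.
Qed.

Definition dual_weight (Dm : R) : R := 2 * Dm * (1 + gamma 1 * (rho / 5)) / rho.

(** The objective is corrected by the squared last dual displacement, whose weight
    grows like 1 / gamma, by a logarithm that absorbs the relative decrease of
    gamma, and by the concave dual regularization - gamma / 2 |y|^2, shifted to be
    nonnegative when Dm bounds |y|^2 on Y. *)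
Definition potential (Dm : R) (r : nat) : R :=
  objective f h g (xs r.+1) (ys r.+1)
  + (2 / (rho ^+ 2 * gamma r) + 9 / 10 / rho) * enorm (ys r.+1 - ys r) ^+ 2
  + dual_weight Dm * ln (gamma r) + gamma r * (Dm - enorm (ys r.+1) ^+ 2) / 2.

(** What remains of the coefficient of |dx|^2 after the Young inequalities that
    separate dx from dy. *)
Definition x_weight r : R :=
  beta r + min_modulus mu / 2 - 2 * `|Ly| ^+ 2 / (rho * gamma r ^+ 2)
  - rho * `|Ly| ^+ 2.

Lemma potential_step (Dm : R) r : (forall u, Y u -> enorm u ^+ 2 <= Dm) ->
  (1 <= r)%N ->
  potential Dm r.+1 + x_weight r.+1 * enorm (xs r.+2 - xs r.+1) ^+ 2
    + 7 / 20 / rho * enorm (ys r.+2 - ys r.+1) ^+ 2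
  <= potential Dm r.
Proof.
move=> YDm r1.
pose dl := ys r.+1 - ys r; pose D := ys r.+2 - ys r.+1.
have y2E : enorm (ys r.+2) ^+ 2 =
    enorm (ys r.+1) ^+ 2 + 2 * dotp (ys r.+1) D + enorm D ^+ 2.
  by rewrite -sqr_enormD /D addrC subrK.
have Y1 : Y (ys r.+1) by apply: ys_feasible.
have Y2 : Y (ys r.+2) by apply: ys_feasible.
have V1 := y_variational r1 Y2.
have V2 := y_variational (isT : (1 <= r.+1)%N) Y1.
have FL := F_lipschitz (xs_feasible (isT : (1 <= r.+1)%N))
  (xs_feasible (isT : (1 <= r.+2)%N)).
have CS := dotp_le_enorm (F (xs r.+2) - F (xs r.+1)) D.
have desc := x_descent (isT : (1 <= r.+1)%N).
have := @potential_step_arith R rho (gamma r.+1) (gamma r) `|Ly|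
  (enorm (xs r.+2 - xs r.+1)) (enorm D) (enorm dl ^+ 2) (dotp dl D)
  (dotp (ys r.+1) D) (enorm (ys r.+1) ^+ 2) Dm (1 + gamma 1 * (rho / 5))
  (dotp (F (xs r.+2) - F (xs r.+1)) D) (g (ys r.+1)) (g (ys r.+2))
  (dotp (F (xs r.+2)) D)
  (objective f h g (xs r.+1) (ys r.+1)) (objective f h g (xs r.+2) (ys r.+1))
  (objective f h g (xs r.+2) (ys r.+2)) (beta r.+1 + min_modulus mu / 2).
rewrite -y2E -/dl -/D; rewrite -/(dual_weight Dm).
rewrite /potential /x_weight -/dl -/D; apply => //.
- exact: C3_positive hC3 _ _.
- exact: gamma_nonincreasing.
- exact: gamma_ratio_le.
- exact: C3_inverse hC3 _ r1.
- exact: sqr_ge0.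
- have := sqr_ge0 (enorm (dl + - D)).
  by rewrite sqr_enormD (dotpNr D) (enormN D); lra.
- exact: sqr_ge0.
- exact: sqr_ge0.
- exact: YDm.
- by apply: le_trans CS _; rewrite ler_wpM2r// enorm_ge0.
- move: V1; rewrite -/D -/dl !(dotpDl, dotpNl, dotpZl, dotpBl).
  by set a := dotp _ _; set b := dotp _ _; set c := dotp _ _; lra.
- move: V2; rewrite -(opprB (ys r.+2)) -/D dotpNr.
  rewrite (dotpBl (_ + _)) (dotpDl (_ *: D)) !dotpZl -sqr_enorm_rV.
  have -> : dotp (ys r.+2) D = dotp (ys r.+1) D + enorm D ^+ 2.
    by rewrite sqr_enorm_rV -dotpDl /D [ys r.+1 + _]addrC subrK.
  by lra.
- by rewrite /objective; lra.
- have -> : dotp (F (xs r.+2)) D = dotp (ys r.+2) (F (xs r.+2)) - dotp (ys r.+1) (F (xs r.+2)).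
    by rewrite dotpC -dotpBl.
  by rewrite /objective !hC4; lra.
Qed.

(** * The stationarity gap *)

Lemma Py_argmin w :
  is_argmin Y (fun u => g u + rho^-1 / 2 * enorm (u - w) ^+ 2) (Py g Y rho w).
Proof.
have r2 : (2 * rho)^-1 = rho^-1 / 2 by rewrite invfM mulrC.
have : exists u, is_argmax Y (fun u => - g u - (2 * rho)^-1 * enorm (u - w) ^+ 2) u.
  have [||u [Yu umin]] := @exists_argmin_convex _ _ Y
    (fun u => g u + rho^-1 / 2 * enorm (u - w) ^+ 2) (A1_Y_compact hA).
  - by exists (ys 1); exact: HiBSA_y1 halg.
  - apply: convex_functionD; first exact: A2_g_convex hA.
    by apply: convex_sqr_enorm; rewrite divr_ge0// invr_ge0 ltW.
  - by exists u; split => // v /umin; rewrite r2; lra.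
move=> /getPex[Yq qmax]; split=> // v /qmax; rewrite r2 /Py r2.
by lra.
Qed.

(** The proximal point q and y = y^(r+1) satisfy variational inequalities with
    linear terms (q - y) / rho - F and dy / rho + gamma y - F; testing each at the
    other point bounds their distance. *)
Lemma gap_y_le r : (1 <= r)%N ->
  enorm (rho^-1 *: (ys r.+1 - Py g Y rho (ys r.+1 + rho *: grady f (xs r.+1, ys r.+1))))
  <= rho^-1 * enorm (ys r.+1 - ys r) + gamma r * enorm (ys r.+1).
Proof.
move=> r1; rewrite (grady_linear _ hC4) /=.
set w := ys r.+1 + rho *: _; set q := Py _ _ _ _; set y := ys r.+1.
have i0 : 0 < rho^-1 by rewrite invr_gt0.
have g0 := C3_positive hC3 r1.
have qmin := Py_argmin w.
have Yq : Y q by case: qmin.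
have Yy : Y y by apply: ys_feasible.
have := prox_variational (A1_Y_convex hA) (A2_g_convex hA) qmin Yy.
have := y_variational r1 Yq.
rewrite -/q -/y; set D := y - ys r; set a := y - q.
have -> : q - y = - a by rewrite opprB.
have -> : q - w = - (a + rho *: F (xs r.+1)).
  by apply/rowP => j; rewrite /w /a !mxE; ring.
rewrite scalerN (scalerDr _ a) scalerA mulVf ?gt_eqF// scale1r.
rewrite dotpNr (dotpNl (_ + _)) (dotpBl (_ + _)) (dotpDl (_ *: a)) (dotpDl (_ *: D)) !(dotpZl _ _ a).
move=> V1 V2.
rewrite enormZ ger0_norm; last exact: ltW.
have yn := enorm_ge0 y; have an := enorm_ge0 a; have Dn := enorm_ge0 D.
apply: ler_cancel_sqr => //; first by rewrite addr_ge0// mulr_ge0// ltW.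
have h1 := dotp_le_enorm (- D) a; have h2 := dotp_le_enorm (- y) a.
rewrite (dotpNl D) enormN in h1; rewrite (dotpNl y) enormN in h2.
have {}h1 : rho^-1 * (- dotp D a) <= rho^-1 * (enorm D * enorm a) by rewrite ler_wpM2l// ltW.
have {}h2 : gamma r * (- dotp y a) <= gamma r * (enorm y * enorm a) by rewrite ler_wpM2l// ltW.
move: V1 V2; rewrite (sqr_enorm_rV a); move: h1 h2.
by set p1 := dotp D a; set p2 := dotp y a; set p3 := dotp a a; set p4 := dotp (F _) a; lra.
Qed.

Lemma Px_argmin (b : R) i v : 0 <= b ->
  is_argmin (X i) (fun u => h i u + b / 2 * enorm (u - v) ^+ 2) (Px h X b i v).
Proof.
move=> b0; apply: getPex; apply: exists_argmin_convex.
- exact: A1_X_compact hA i.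
- by exists (row i (xs 1)); exact: HiBSA_x1 halg i.
- apply: convex_functionD; first exact: A2_h_convex hA i.
  by apply: convex_sqr_enorm; rewrite divr_ge0.
Qed.

Lemma enorm_sub_splice_le i (x' x : 'M[R]_(K.+1, N)) :
  enorm (x' - splice i x' x) <= enorm (x' - x).
Proof.
rewrite ler_wsqrtr//; apply: ler_sum => k _; apply: ler_sum => j _.
rewrite !mxE; case: ifP => // _.
by rewrite subrr expr0n sqr_ge0.
Qed.

(** As for the dual block.  The two linear terms are the gradient of f at the new
    point and the gradient of U_i at the new block plus beta dx_i; they are compared
    through the gradient at the old block, where those of U_i and f agree.  The
    bound does not depend on b. *)
Lemma gap_x_le (b : R) r i : (1 <= r)%N -> 0 < b -> 0 <= Lx i -> 0 <= beta r ->
  enorm (b *: (row i (xs r.+1) - Px h X b i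
    (row i (xs r.+1) - b^-1 *: gradx f i (xs r.+1, ys r.+1))))
  <= (beta r + Lx i + `|Lu i|) * enorm (xs r.+1 - xs r)
     + Lx i * enorm (ys r.+1 - ys r).
Proof.
move=> r1 b0 L0 bet0; set G := gradx _ _ _; set w := _ - b^-1 *: _; set p := Px _ _ _ _ _.
set u := row i (xs r.+1).
have Xx' : prodX X (xs r.+1) by exact: xs_feasible.
have Xx : prodX X (xs r) by exact: xs_feasible.
have Yy : Y (ys r) by exact: ys_feasible.
have Yy' : Y (ys r.+1) by exact: ys_feasible.
have Xs : prodX X (splice i (xs r.+1) (xs r)) by exact: splice_feasible.
have Xu : X i u by exact: Xx'.
have pmin := Px_argmin i w (ltW b0).
have Xp : X i p by case: pmin.
have cXi : convex_set (X i) by exact: A1_X_convex hA i.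
have chi : convex_function setT (h i) by exact: A2_h_convex hA i.
have := prox_variational cXi chi pmin Xu.
have := x_variational r1 Xp.
have := B2_gradient hB i Xs Yy; rewrite row_splice.
have := B4_lipschitz hB Xs Yy (Xx i) Xu.
have := A3_gradx_lipschitz hA i (z := (splice i (xs r.+1) (xs r), ys r))
  (z' := (xs r.+1, ys r.+1)) (conj Xs Yy) (conj Xx' Yy').
rewrite -/p -/u -/G.
set H := grad _ u; set H0 := grad _ (row i (xs r)); set G0 := gradx _ _ _.
set D := u - row i (xs r) => LG LH HG; rewrite {}HG in LH.
have -> : p - w = - (u - p) + b^-1 *: G by apply/rowP => j; rewrite /w !mxE; ring.
have -> : p - u = - (u - p) by rewrite opprB.
set a := u - p.
have an := enorm_ge0 a.
have dn := enorm_ge0 (xs r.+1 - xs r); have en := enorm_ge0 (ys r.+1 - ys r).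
have Du : enorm D <= enorm (xs r.+1 - xs r).
  rewrite (_ : D = row i (xs r.+1 - xs r)) ?enorm_row_le//.
  by apply/rowP => j; rewrite !mxE.
have {}LH : enorm (H - G0) <= `|Lu i| * enorm (xs r.+1 - xs r).
  apply: (le_trans LH); rewrite enorm_sub_sym -/D.
  apply: (@le_trans _ _ (`|Lu i| * enorm D)); last by rewrite ler_wpM2l.
  by rewrite ler_wpM2r ?ler_norm// enorm_ge0.
have {}LG : enorm (G - G0) <= Lx i * (enorm (xs r.+1 - xs r) + enorm (ys r.+1 - ys r)).
  apply: (le_trans LG); rewrite ler_wpM2l// (le_trans (enorm2_leD _))//= lerD2r.
  exact: enorm_sub_splice_le.
rewrite (scalerDr _ (- a)) scalerA divff ?gt_eqF// scale1r scalerN.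
rewrite (dotpDl (- _)) (dotpNl (_ *: a)) (dotpZl _ _ a) (dotpNr a) (dotpDl H) (dotpZl _ D).
move=> V1 V2.
rewrite enormZ gtr0_norm//; apply: ler_cancel_sqr => //.
  by rewrite addr_ge0// mulr_ge0// !addr_ge0.
have c1 := dotp_le_enorm (G - G0) a.
have c2 := dotp_le_enorm (- (H - G0)) a.
have c3 := dotp_le_enorm (- D) a.
rewrite enormN in c2; rewrite enormN in c3.
rewrite (dotpNl (_ - _)) !(dotpBl _ G0) in c1 c2; rewrite (dotpNl D) in c3.
have {}LG := ler_wpM2r an LG; have {}LH := ler_wpM2r an LH.
have {}Du := ler_wpM2l bet0 (le_trans c3 (ler_wpM2r an Du)).
move: V1 V2 c1 c2 LG LH Du; rewrite (sqr_enorm_rV a).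
set p1 := dotp D a; set p2 := dotp H a; set p3 := dotp a a; set p4 := dotp G a.
by set p5 := dotp G0 a; lra.
Qed.

(** A negative Lipschitz constant forces X x Y to be a single point.  Then beta
    may be negative, but the proximal points have no other value to take. *)
Lemma gap_eq0 i r : Lx i < 0 -> (1 <= r)%N ->
  enorm2 (gap f h g X Y (beta r.+1) rho (xs r.+1) (ys r.+1)) = 0.
Proof.
move=> Li r1.
have eqz z z' : (prodX X `*` Y) z -> (prodX X `*` Y) z' -> z' = z.
  move=> Hz Hz'; apply/subr0_eq/enorm2_eq0.
  have := A3_gradx_lipschitz hA i Hz Hz'.
  have := enorm_ge0 (gradx f i z' - gradx f i z).
  have := enorm2_ge0 (z' - z); set a := enorm2 _; set b := enorm _ => a0 b0 ab.
  by apply/eqP; rewrite eq_le a0 andbT leNgt; apply/negP => a1; nra.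
set x := xs r.+1; set y := ys r.+1.
have Xx : prodX X x by exact: xs_feasible.
have Yy : Y y by exact: ys_feasible.
have X1 k v : X k v -> v = row k x.
  move=> Xv; have rowE l : row l (subst_block x k v) = if l == k then v else row l x.
    by apply/rowP => j; rewrite !mxE; case: eqP => //; rewrite mxE.
  have Xs : prodX X (subst_block x k v).
    by move=> l; rewrite rowE; case: eqP => [->//|_]; exact: Xx.
  have [<-] := eqz (x, y) (subst_block x k v, y) (conj Xx Yy) (conj Xs Yy).
  by rewrite rowE eqxx.
have Y1 v : Y v -> v = y.
  by move=> Yv; have [] := eqz (x, y) (x, v) (conj Xx Yy) (conj Xx Yv).
have Py1 w : Py g Y rho w = y by apply: Y1; case: (Py_argmin w).
have Px1 b k w : Px h X b k w = row k x.
  have : exists u, is_argmin (X k) (fun u => h k u + b / 2 * enorm (u - w) ^+ 2) u.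
    by exists (row k x); split=> [|v /X1 ->//]; exact: Xx.
  by move=> /getPex[/X1].
suff -> : gap f h g X Y (beta r.+1) rho x y = 0.
  by rewrite /enorm2 /= !enorm0 expr0n addr0 sqrtr0.
rewrite /gap Py1 subrr scaler0; congr (_, _).
by apply/row_matrixP => k; rewrite rowK Px1 subrr scaler0 row0.
Qed.

Context (hL : forall i, 0 <= Lx i).

Lemma beta_gt0 r : (1 <= r)%N -> 0 < beta r.
Proof. by move=> r1; exact: le_lt_trans (hL ord0) (C3_beta_Lx hC3 ord0 r1). Qed.

(** If Ly = 0 the coupling costs nothing and strong convexity provides the constant
    term.  Otherwise the lower bound on beta leaves half of beta after
    paying for the coupling, and it tends to infinity since gamma vanishes. *)
Lemma x_weight_ge : exists2 c : R, 0 < c & exists r0, forall r, (r0 <= r)%N ->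
  (1 <= r)%N /\ c * (beta r + 1) <= x_weight r.
Proof.
have mu0 := min_modulus_gt0 (B1_modulus hB).
pose m := min_modulus mu; pose L2 := `|Ly| ^+ 2.
have L2E : L2 = Ly ^+ 2 by rewrite /L2 real_normK// num_real.
have [Ly0|Ly0] := eqVneq Ly 0.
  exists (Num.min 1 (m / 2)); first by rewrite lt_min ltr01 divr_gt0.
  exists 1%N => r r1; split=> //.
  rewrite /x_weight -/L2 L2E Ly0 expr0n/= !mulr0 mul0r !subr0 mulrDr mulr1 lerD//.
    by rewrite -[X in _ <= X]mul1r ler_wpM2r ?(ltW (beta_gt0 r1))// ge_min lexx.
  by rewrite ge_min lexx orbT.
have L20 : 0 < L2 by rewrite /L2 exprn_gt0// normr_gt0.
(* Once gamma^2 <= 4 L2 / q, beta is at least 1 + 2 m + 2 rho L2. *)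
pose q := rho * (1 + 4 * m + rho * L2).
have q0 : 0 < q.
  by rewrite mulr_gt0// addr_gt0// ?addr_gt0// mulr_gt0.
exists 4^-1; first by rewrite invr_gt0.
have d0 : 0 < Num.min 1 (4 * L2 / q) by rewrite lt_min ltr01 divr_gt0// mulr_gt0.
have /cvgrPdist_le/(_ _ d0)[r0 _ Hr0] := C3_vanishing hC3.
exists (maxn r0 1) => r; rewrite geq_max => /andP[r0r r1]; split=> //.
have g0 := C3_positive hC3 r1.
have := Hr0 r r0r; rewrite /= sub0r normrN (gtr0_norm g0) le_min => /andP[gle1 gleq].
have bet := C3_beta hC3 r1.
have G : 1 + 4 * m + rho * L2 <= 4 * L2 / (rho * gamma r ^+ 2).
  rewrite ler_pdivlMr ?mulr_gt0 ?exprn_gt0//.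
  rewrite mulrA [_ * rho]mulrC -/q.
  rewrite ler_pdivlMr// in gleq.
  apply: le_trans gleq; rewrite mulrC ler_wpM2r ?(ltW q0)//.
  by rewrite expr2 -[X in _ <= X]mulr1 ler_wpM2l// ltW.
rewrite -L2E -/m in bet; rewrite /x_weight -/L2 -/m.
have E : 4 * L2 / (rho * gamma r ^+ 2) = 2 * (2 * L2 / (rho * gamma r ^+ 2)) by lra.
rewrite E in bet G; move: bet G; set w := 2 * L2 / _; set w2 := rho * L2.
by move=> bet G; lra.
Qed.

(** Only the logarithm of gamma can be unbounded below, and 1 / gamma grows at most
    linearly. *)
Lemma potential_ge (Dm : R) : 0 <= Dm -> (forall u, Y u -> enorm u ^+ 2 <= Dm) ->
  exists2 A : R, 0 <= A & forall r, (1 <= r)%N ->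
    - (A * (1 + ln r%:R)) <= potential Dm r.
Proof.
move=> Dm0 YDm; have [lb Hlb] := A1_lower_bound hA.
have g10 := C3_positive hC3 (isT : (1 <= 1)%N).
pose a := (gamma 1)^-1 + rho / 5.
have r50 : 0 <= rho / 5 by rewrite divr_ge0// ltW.
have a0 : 0 < a by rewrite ltr_pwDl// invr_gt0.
have w0 : 0 <= dual_weight Dm.
  by rewrite divr_ge0 ?(ltW hrho)// !mulr_ge0// addr_ge0// mulr_ge0// ltW.
exists (`|lb| + dual_weight Dm * (`|ln a| + 1)).
  by rewrite addr_ge0// mulr_ge0// addr_ge0.
move=> r r1; have g0 := C3_positive hC3 r1.
have r1R : 1 <= r%:R :> R by rewrite ler1n.
have r0R : 0 < r%:R :> R by rewrite ltr0n.
have lnr : 0 <= ln r%:R :> R by rewrite ln_ge0.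
have lng : - (`|ln a| + ln r%:R) <= ln (gamma r).
  rewrite lerNl -lnV ?posrE//.
  have : ln (gamma r)^-1 <= ln (a * r%:R).
    rewrite ler_ln ?posrE ?invr_gt0 ?mulr_gt0//.
    apply: le_trans (gamma_inv_le r1) _.
    rewrite mulrDl lerD2r -[X in X <= _]mulr1 ler_wpM2l// invr_ge0; exact: ltW.
  rewrite lnM ?posrE// => /le_trans; apply; rewrite lerD2r; exact: ler_norm.
have obj : - `|lb| <= objective f h g (xs r.+1) (ys r.+1).
  apply: le_trans (Hlb _ _ (xs_feasible _) (ys_feasible _)) => //.
  by rewrite lerNl -normrN ler_norm.
have t2 : 0 <= (2 / (rho ^+ 2 * gamma r) + 9 / 10 / rho) * enorm (ys r.+1 - ys r) ^+ 2.
  rewrite mulr_ge0 ?sqr_ge0// addr_ge0// ?divr_ge0// ?mulr_ge0 ?sqr_ge0//; exact: ltW.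
have t4 : 0 <= gamma r * (Dm - enorm (ys r.+1) ^+ 2) / 2.
  rewrite divr_ge0// mulr_ge0 ?(ltW g0)// subr_ge0 YDm//; exact: ys_feasible.
rewrite /potential; set w := dual_weight _ in w0 *.
have {}lng := ler_wpM2l w0 lng.
have p1 : 0 <= `|lb| * ln r%:R by rewrite mulr_ge0.
have p2 : 0 <= w * `|ln a| * ln r%:R by rewrite mulr_ge0// mulr_ge0.
move: lng t2 t4 obj p1 p2; set t2 := _ * enorm _ ^+ 2; set t4 := _ / 2.
by lra.
Qed.

(** The primal gap is of order (beta + 1) |dx| and the potential loses a multiple of
    (beta + 1) |dx|^2: hence the factor beta + 1 in front of the loss D r.  The
    displacements between the iterates r and r + 1 are those of the step r - 1 of
    the potential, whence the shift in P and the bound 2 <= r. *)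
Lemma gap_decrease :
  exists D P : nat -> R, exists r0 : nat, exists C A : R,
  [/\ 0 <= C, 0 <= A,
     forall r, (r0 <= r)%N -> [/\ (2 <= r)%N, 0 <= D r & P r.+1 + D r <= P r],
     forall r, (r0 <= r)%N -> - (A * (1 + ln r%:R)) <= P r
   & forall r, (r0 <= r)%N ->
     enorm2 (gap f h g X Y (beta r.+1) rho (xs r.+1) (ys r.+1)) ^+ 2
       <= C * ((beta r + 1) * D r + gamma r ^+ 2)].
Proof.
have [c c0 [r0 Hc]] := x_weight_ge.
have [Dm Dm0 YDm] := compact_sqr_enorm_bounded (A1_Y_compact hA).
have [A A0 HA] := potential_ge Dm0 YDm.
pose d r := enorm (xs r.+1 - xs r); pose e r := enorm (ys r.+1 - ys r).
pose D r := c * (beta r + 1) * d r ^+ 2 + 7 / 20 / rho * e r ^+ 2.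
pose P r := potential Dm r.-1.
pose S := 1 + \sum_i (Lx i + `|Lu i|).
pose Q := K.+1%:R * (2 * S ^+ 2 * (c^-1 + 20 / 7 * rho)) + 2 * (20 / 7 * rho^-1) + 2 * Dm.
have S1 : 1 <= S by rewrite lerDl; apply: sumr_ge0 => i _; rewrite addr_ge0.
have i0 : 0 < rho^-1 by rewrite invr_gt0.
have cr : 0 <= c^-1 + 20 / 7 * rho.
  by rewrite addr_ge0 ?invr_ge0 ?(ltW c0)// mulr_ge0// ltW.
have q1 : 0 <= K.+1%:R * (2 * S ^+ 2 * (c^-1 + 20 / 7 * rho)).
  by rewrite mulr_ge0// mulr_ge0// mulr_ge0// sqr_ge0.
have D0 r : (maxn r0 2 <= r)%N -> [/\ (1 <= r)%N, 0 < beta r & 0 <= D r].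
  rewrite geq_max => /andP[rr0 r2]; have r1 : (1 <= r)%N by apply: leq_trans r2.
  have b0 := beta_gt0 r1; split=> //.
  rewrite addr_ge0// mulr_ge0 ?sqr_ge0//.
    by rewrite mulr_ge0 ?(ltW c0)// addr_ge0// ltW.
  by rewrite mulr_ge0// ltW.
exists D, P, (maxn r0 2), Q, A; split=> //.
- have q2 : 0 <= 2 * (20 / 7 * rho^-1) by rewrite mulr_ge0// mulr_ge0// ltW.
  by rewrite /Q; lra.
- move=> r rr0; have [r1 b0 Dr0] := D0 r rr0; move: rr0 Dr0.
  rewrite geq_max => /andP[rr0 r2] Dr0; split=> //.
  have := potential_step YDm (r := r.-1).
  case: r r1 r2 rr0 b0 Dr0 => // r r1 r2 rr0 b0 Dr0 /(_ r2) /=.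
  rewrite /P /D /= => /(le_trans _); apply.
  rewrite -/(d r.+1) -/(e r.+1) addrA lerD2r lerD2l ler_wpM2r ?sqr_ge0//.
  by case: (Hc _ rr0).
- move=> r; rewrite geq_max => /andP[_ r2]; rewrite /P.
  case: r r2 => // r r2; apply: le_trans (HA r r2); rewrite lerN2 ler_wpM2l// lerD2l.
  by rewrite ler_ln ?posrE ?ltr0n// ler_nat.
- move=> r rr0; have [r1 b0 Dr0] := D0 r rr0.
  rewrite sqr_enorm2 /=.
  have dn : 0 <= d r by exact: enorm_ge0.
  have en : 0 <= e r by exact: enorm_ge0.
  have gy := gap_y_le r1; rewrite -/(e r) in gy.
  have Yy : enorm (ys r.+1) ^+ 2 <= Dm by apply: YDm; exact: ys_feasible.
  have g0 := C3_positive hC3 r1.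
  have e2 : e r ^+ 2 <= 20 / 7 * rho * D r.
    have : 0 <= c * (beta r + 1) * d r ^+ 2.
      by rewrite mulr_ge0 ?sqr_ge0// mulr_ge0 ?(ltW c0)// addr_ge0// ltW.
    move=> /(mulr_ge0 (ltW hrho)).
    have -> : 20 / 7 * rho * D r =
        20 / 7 * (rho * (c * (beta r + 1) * d r ^+ 2)) + e r ^+ 2.
      by rewrite /D; field; rewrite gt_eqF.
    by lra.
  have d2 : (beta r + 1) * d r ^+ 2 <= c^-1 * D r.
    rewrite ler_pdivlMl//.
    have : 0 <= 7 / 20 / rho * e r ^+ 2.
      by rewrite mulr_ge0 ?sqr_ge0// divr_ge0// ltW.
    by rewrite /D; lra.
  have SL i : Lx i + `|Lu i| <= S.
    have : 0 <= \sum_(j < K.+1 | j != i) (Lx j + `|Lu j|).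
      by apply: sumr_ge0 => j _; rewrite addr_ge0.
    by move=> s0; rewrite /S (bigD1 i)//=; move: s0; lra.
  have block i : enorm (row i (gap f h g X Y (beta r.+1) rho (xs r.+1) (ys r.+1)).1) ^+ 2
      <= 2 * S ^+ 2 * (c^-1 + 20 / 7 * rho) * ((beta r + 1) * D r).
    rewrite /gap rowK.
    have := gap_x_le r1 (beta_gt0 (isT : (1 <= r.+1)%N)) (hL i) (ltW b0).
    rewrite -/(d r) -/(e r); set t := enorm _ => ht.
    have {}ht : t <= S * ((beta r + 1) * d r + e r).
      apply: (le_trans ht); rewrite mulrDr mulrA lerD// ler_wpM2r//.
        rewrite mulrDr mulr1 -addrA lerD// -[X in X <= _]mul1r ler_wpM2r// ltW//.
      by apply: le_trans (SL i); rewrite lerDl.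
    have {}ht : t ^+ 2 <= (S * ((beta r + 1) * d r + e r)) ^+ 2.
      by rewrite ler_pXn2r// nnegrE ?enorm_ge0// (le_trans (enorm_ge0 _) ht).
    apply: (le_trans ht).
    have : 0 <= ((beta r + 1) * d r - e r) ^+ 2 by exact: sqr_ge0.
    have b1 : 1 <= beta r + 1 by rewrite lerDr ltW.
    have {}d2 : (beta r + 1) ^+ 2 * d r ^+ 2 <= (beta r + 1) * (c^-1 * D r).
      by rewrite expr2 -mulrA ler_wpM2l// addr_ge0// ltW.
    have {}e2 : e r ^+ 2 <= (beta r + 1) * (20 / 7 * rho * D r).
      apply: (le_trans e2); rewrite -[X in X <= _]mul1r ler_wpM2r//.
      by rewrite mulr_ge0// mulr_ge0// ltW.
    move=> h1; have : ((beta r + 1) * d r + e r) ^+ 2 <=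
      2 * ((beta r + 1) * (c^-1 * D r)) + 2 * ((beta r + 1) * (20 / 7 * rho * D r)) by lra.
    by move=> /(ler_wpM2l (sqr_ge0 S)); lra.
  have blocky : enorm (gap f h g X Y (beta r.+1) rho (xs r.+1) (ys r.+1)).2 ^+ 2
      <= 2 * (20 / 7 * rho^-1) * ((beta r + 1) * D r) + 2 * Dm * gamma r ^+ 2.
    move: gy; rewrite /gap /=; set t := enorm (_ *: _) => gy.
    have {}gy : t ^+ 2 <= (rho^-1 * e r + gamma r * enorm (ys r.+1)) ^+ 2.
      by rewrite ler_pXn2r// nnegrE ?enorm_ge0// (le_trans (enorm_ge0 _) gy).
    apply: (le_trans gy).
    have : 0 <= (rho^-1 * e r - gamma r * enorm (ys r.+1)) ^+ 2 by exact: sqr_ge0.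
    have := ler_wpM2l (sqr_ge0 (gamma r)) Yy.
    have := ler_wpM2l (sqr_ge0 rho^-1) e2.
    have -> : rho^-1 ^+ 2 * (20 / 7 * rho * D r) = 20 / 7 * rho^-1 * D r.
      by field; rewrite gt_eqF.
    have : 0 <= 20 / 7 * rho^-1 * (beta r * D r).
      by rewrite mulr_ge0 ?mulr_ge0// ltW.
    by lra.
  rewrite sqr_enorm_rows.
  have : \sum_i enorm (row i (gap f h g X Y (beta r.+1) rho (xs r.+1) (ys r.+1)).1) ^+ 2
     <= \sum_(i < K.+1) 2 * S ^+ 2 * (c^-1 + 20 / 7 * rho) * ((beta r + 1) * D r).
    by apply: ler_sum => i _; exact: block.
  rewrite sumr_const card_ord -mulr_natl.
  have bD : 0 <= (beta r + 1) * D r by rewrite mulr_ge0// addr_ge0// ltW.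
  have g2 : 0 <= K.+1%:R * (2 * S ^+ 2 * (c^-1 + 20 / 7 * rho)) * gamma r ^+ 2.
    by rewrite mulr_ge0 ?sqr_ge0.
  have g3 : 0 <= 2 * (20 / 7 * rho^-1) * gamma r ^+ 2.
    by rewrite mulr_ge0 ?sqr_ge0// mulr_ge0// mulr_ge0// ltW.
  have g4 : 0 <= 2 * Dm * ((beta r + 1) * D r) by rewrite mulr_ge0 ?(mulr_ge0 _ Dm0).
  move: blocky; rewrite /Q; set G1 := \sum_(_ < _) _; set G2 := enorm _ ^+ 2.
  by move=> k1 k2; lra.
Qed.

End HiBSA.

(** * From the decrease of the potential to the complexity bound *)

Section Rate.
Context {R : realType}.

Lemma near_oo_ge (x : R) : exists r0, forall r, (r0 <= r)%N -> x <= r%:R.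
Proof.
exists (Num.truncn x).+1 => r rr; apply: (le_trans (ltW (truncnS_gt x))).
by rewrite ler_nat.
Qed.

Lemma ln_nat_ge1 : exists r0, forall r, (r0 <= r)%N ->
  (1 <= r)%N /\ 1 <= ln r%:R :> R.
Proof.
have [r0 Hr0] := near_oo_ge (expR 1).
exists r0 => r /Hr0 re; have r0R : 0 < r%:R :> R := lt_le_trans (expR_gt0 1) re.
split; first by rewrite -(ltr0n R).
by rewrite -[X in X <= _](expRK (1 : R)) ler_ln ?posrE// expR_gt0.
Qed.

Lemma softOP (T : Type) (F : filter_on T) (u v : T -> R) :
  softO F u v <-> exists (k : nat) (C : R),
    0 < C /\ \forall t \near F, `|u t| <= C * (`|v t| * `|ln (v t)| ^+ k).
Proof.
have E k t : `|v t * `|ln (v t)| ^+ k| = `|v t| * `|ln (v t)| ^+ k.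
  by rewrite normrM normrX normr_id.
split=> [[k /eqO_exP[C C0 H]]|[k [C [C0 H]]]]; exists k.
  by exists C; split=> //; apply: filterS H => t; rewrite -E.
by apply/eqO_exP; exists C => //; apply: filterS H => t; rewrite -E.
Qed.

Lemma rate_parameters_bounds (gamma beta : nat -> R) :
  rate_parameters gamma beta ->
  exists (k : nat) (C : R) (r1 : nat), 0 <= C /\ forall r, (r1 <= r)%N ->
    [/\ (1 <= r)%N, 1 <= ln r%:R :> R,
        `|beta r| <= C * Num.sqrt r%:R * ln r%:R ^+ k &
        gamma r ^+ 2 <= C * (Num.sqrt r%:R)^-1 * ln r%:R ^+ k].
Proof.
move=> [/softOP[k1 [C1 [C10 [r1 _ H1]]]] /softOP[k2 [C2 [C20 [r2 _ H2]]]]].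
have [r3 H3] := ln_nat_ge1.
exists (k2 + k1 * 2)%N, (C2 + C1 ^+ 2), (maxn r1 (maxn r2 r3)).
split; first by rewrite addr_ge0 ?sqr_ge0// ltW.
move=> r; rewrite !geq_max => /and3P[/H1 {}H1 /H2 {}H2 /H3 [rge1 l1]].
have l0 : 0 <= ln r%:R :> R by apply: le_trans l1.
have rR : 0 < r%:R :> R by rewrite ltr0n.
pose s : R := Num.sqrt r%:R; pose q : R := r%:R `^ (- 4^-1).
have s0 : 0 <= s by exact: sqrtr_ge0.
have lnq : `|ln q| <= ln r%:R.
  rewrite /q ln_powR normrM normrN (ger0_norm l0) -[X in _ <= X]mul1r ler_wpM2r//.
  by rewrite ger0_norm ?invr_ge0// invf_le1// ler1n.
have lns : `|ln s| <= ln r%:R.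
  rewrite /s -powR12_sqrt ?ler0n// ln_powR normrM (ger0_norm l0).
  by rewrite -[X in _ <= X]mul1r ler_wpM2r// ger0_norm ?invr_ge0// invf_le1// ler1n.
have q2 : q ^+ 2 = s^-1.
  rewrite /q powRN exprVn -powR_mulrn ?powR_ge0// -powRrM /s -powR12_sqrt ?ler0n//.
  by congr (_ `^ _)^-1; field.
have {}H1 : `|gamma r| <= C1 * (`|q| * `|ln q| ^+ k1) by exact: H1.
have {}H2 : `|beta r| <= C2 * (s * `|ln s| ^+ k2) by rewrite -{1}(ger0_norm s0).
split=> //.
- change (`|beta r| <= (C2 + C1 ^+ 2) * s * ln r%:R ^+ (k2 + k1 * 2)).
  apply: (le_trans H2); rewrite mulrA.
  apply: ler_pM; rewrite ?exprn_ge0 ?mulr_ge0 ?(ltW C20)//.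
    by apply: (ler_wpM2r s0); rewrite lerDl sqr_ge0.
  apply: (@le_trans _ _ (ln r%:R ^+ k2)); first by rewrite lerXn2r// ?nnegrE.
  by rewrite ler_weXn2l// leq_addr.
- change (gamma r ^+ 2 <= (C2 + C1 ^+ 2) * s^-1 * ln r%:R ^+ (k2 + k1 * 2)).
  have : `|gamma r| ^+ 2 <= (C1 * (`|q| * `|ln q| ^+ k1)) ^+ 2.
    by rewrite lerXn2r// ?nnegrE// mulr_ge0 ?(ltW C10)// mulr_ge0// exprn_ge0.
  rewrite real_normK ?num_real// => /le_trans; apply.
  rewrite !exprMn -exprM real_normK ?num_real// q2 mulrA.
  apply: ler_pM; rewrite ?exprn_ge0 ?mulr_ge0 ?invr_ge0 ?(ltW C10) ?sqr_ge0//.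
    by apply: (@ler_wpM2r R); rewrite ?invr_ge0// lerDr ltW.
  apply: (@le_trans _ _ (ln r%:R ^+ (k1 * 2))); first by rewrite lerXn2r// ?nnegrE.
  by rewrite ler_weXn2l// leq_addl.
Qed.

(** One of the T losses incurred from T to 2 T is at most their mean. *)
Lemma exists_small_decrease (P D : nat -> R) r0 (T : nat) :
  (forall r, (r0 <= r)%N -> 0 <= D r /\ P r.+1 + D r <= P r) -> (r0 <= T)%N ->
  (0 < T)%N ->
  exists r, [/\ (T <= r)%N, (r < 2 * T)%N & T%:R * D r <= P r0 - P (2 * T)%N].
Proof.
move=> HD r0T T0; apply: contrapT => Hn.
have big r : (T <= r)%N -> (r < 2 * T)%N -> P r0 - P (2 * T)%N < T%:R * D r.
  by move=> Tr r2T; rewrite ltNge; apply/negP => Hr; apply: Hn; exists r.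
have decr n : P (r0 + n)%N <= P r0.
  elim: n => [|n IH]; first by rewrite addn0.
  by have [] := HD (r0 + n)%N (leq_addr _ _); rewrite addnS; lra.
have step n : (n < T)%N ->
    P r0 - P (2 * T)%N + T%:R * P (T + n.+1)%N < T%:R * P (T + n)%N.
  move=> nT; have [_ st] := HD (T + n)%N (leq_trans r0T (leq_addr _ _)).
  have b := big (T + n)%N (leq_addr _ _).
  rewrite mul2n -addnn ltn_add2l in b; have {}b := b nT.
  have {}st := ler_wpM2l (ler0n R T) st.
  by rewrite addnS mul2n -addnn; move: b st; lra.
have sum n : (n <= T)%N ->
    n%:R * (P r0 - P (2 * T)%N) + T%:R * P (T + n)%N <= T%:R * P T.
  elim: n => [_|n IH nT]; first by rewrite mul0r addn0 add0r.
  by have := IH (ltnW nT); have := step n nT; rewrite -natr1; lra.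
clear Hn big HD.
case: T T0 r0T step sum => // T _ r0T step sum.
have := step T (ltnSn T); have := sum T (leqnSn T).
have -> : (2 * T.+1 = T.+1 + T.+1)%N by rewrite mul2n addnn.
have := decr (T.+1 - r0)%N; rewrite subnKC// => PT.
have := ler_wpM2l (ler0n R T.+1) PT.
by rewrite -natr1; lra.
Qed.

(** Some r in [T, 2 T) has a loss of order ln T / T; the factor beta of order sqrt T
    leaves T^(-1/2), which is also the order of gamma^2 on that interval. *)
Lemma small_gap (G D P gamma beta : nat -> R) (r0 : nat) (C A : R) :
  rate_parameters gamma beta -> 0 <= C -> 0 <= A ->
  (forall r, (r0 <= r)%N -> [/\ (2 <= r)%N, 0 <= D r & P r.+1 + D r <= P r]) ->
  (forall r, (r0 <= r)%N -> - (A * (1 + ln r%:R)) <= P r) ->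
  (forall r, (r0 <= r)%N -> G r ^+ 2 <= C * ((beta r + 1) * D r + gamma r ^+ 2)) ->
  exists (Q : R) (m T0 : nat), 0 < Q /\ forall T, (T0 <= T)%N ->
    exists r, [/\ (1 <= r)%N, (r < 2 * T)%N &
      G r ^+ 2 <= Q * ln (2 * T)%:R ^+ m / Num.sqrt T%:R].
Proof.
move=> /rate_parameters_bounds[k [B [r1 [B0 HB]]]] C0 A0 HD HP HG.
pose p := `|P r0| + 2 * A.
have p0 : 0 <= p by rewrite addr_ge0// mulr_ge0.
pose Q := C * (2 * (B + 1) * p + B) + 1.
exists Q, k.+1, (maxn r0 r1).
split; first by rewrite ltr_pwDr// mulr_ge0// addr_ge0// mulr_ge0// mulr_ge0// addr_ge0.
move=> T; rewrite geq_max => /andP[r0T r1T].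
have [T1 lT _ _] := HB T r1T.
have [] := @exists_small_decrease P D r0 T _ r0T T1.
  by move=> r rr; have [] := HD r rr.
move=> r [Tr r2T HDr].
have r0r := leq_trans r0T Tr.
have [r2 Dr0 _] := HD r r0r.
have [rge1 lr Hb Hg] := HB r (leq_trans r1T Tr).
exists r; split=> //.
have T0R : 0 < T%:R :> R by rewrite ltr0n.
have rR : 0 < r%:R :> R by rewrite ltr0n.
pose l : R := ln (2 * T)%:R.
have lrl : ln r%:R <= l.
  by rewrite ler_ln ?posrE ?ltr0n ?muln_gt0// ler_nat ltnW.
have l1 : 1 <= l := le_trans lr lrl.
have l0 : 0 <= l := le_trans ler01 l1.
pose s : R := Num.sqrt T%:R; pose t : R := Num.sqrt r%:R.
have s0 : 0 < s by rewrite sqrtr_gt0.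
have t0 : 0 < t by rewrite sqrtr_gt0.
have s2 : s ^+ 2 = T%:R by rewrite sqr_sqrtr// ltW.
have st : s <= t by rewrite ler_wsqrtr// ler_nat.
have t1 : 1 <= t by rewrite -[X in X <= _]sqrtr1 ler_wsqrtr// ler1n.
have ts : t <= 2 * s.
  rewrite -(@ler_pXn2r _ 2)// ?nnegrE ?mulr_ge0 ?(ltW t0) ?(ltW s0)//.
  rewrite sqr_sqrtr ?(ltW rR)// exprMn s2 -natrX -natrM ler_nat.
  by rewrite (leq_trans (ltnW r2T))// leq_mul2r orbT.
have {}Hb : beta r + 1 <= (B + 1) * t * l ^+ k.
  have lk : ln r%:R ^+ k <= l ^+ k by rewrite lerXn2r// nnegrE// (le_trans ler01).
  have lk1 : 1 <= l ^+ k by exact: exprn_ege1.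
  have : 1 * 1 <= t * l ^+ k by apply: ler_pM.
  have : B * t * ln r%:R ^+ k <= B * t * l ^+ k.
    by rewrite ler_wpM2l// mulr_ge0// ltW.
  by have := le_trans (ler_norm (beta r)) Hb; rewrite -/t; lra.
have {}HDr : D r <= p * l / s ^+ 2.
  rewrite s2 ler_pdivlMr// mulrC; apply: (le_trans HDr).
  have := HP (2 * T)%N (leq_trans r0r (ltnW r2T)); rewrite -/l.
  have := ler_norm (P r0).
  have : `|P r0| * 1 <= `|P r0| * l by rewrite ler_wpM2l.
  have : A * 1 <= A * l by rewrite ler_wpM2l.
  by rewrite /p; lra.
have {}Hg : gamma r ^+ 2 <= B * l ^+ k / s.
  apply: (le_trans Hg); rewrite -/t mulrAC; apply: ler_pM.
  - by rewrite mulr_ge0// exprn_ge0// (le_trans ler01).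
  - by rewrite invr_ge0 ltW.
  - by rewrite ler_wpM2l// lerXn2r// nnegrE// (le_trans ler01).
  - by rewrite lef_pV2 ?posrE.
apply: (le_trans (HG r r0r)).
have prod : (beta r + 1) * D r <= (2 * (B + 1) * p) * l ^+ k.+1 / s.
  apply: (@le_trans _ _ ((B + 1) * t * l ^+ k * (p * l / s ^+ 2))).
    apply: (@le_trans _ _ ((B + 1) * t * l ^+ k * D r)).
      by apply: ler_wpM2r.
    by rewrite ler_wpM2l// mulr_ge0 ?exprn_ge0// mulr_ge0 ?addr_ge0// ltW.
  have -> : (B + 1) * t * l ^+ k * (p * l / s ^+ 2) =
      ((B + 1) * p * l ^+ k.+1 / s ^+ 2) * t.
    by rewrite [l ^+ k.+1]exprS; field; rewrite gt_eqF.
  have -> : 2 * (B + 1) * p * l ^+ k.+1 / s = ((B + 1) * p * l ^+ k.+1 / s ^+ 2) * (2 * s).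
    by field; rewrite gt_eqF.
  apply: ler_wpM2l => //; rewrite divr_ge0 ?sqr_ge0// mulr_ge0 ?exprn_ge0//.
  by rewrite mulr_ge0// addr_ge0.
have gam : gamma r ^+ 2 <= B * l ^+ k.+1 / s.
  apply: (le_trans Hg); rewrite ler_wpM2r ?invr_ge0 ?(ltW s0)//.
  by rewrite ler_wpM2l// ler_weXn2l.
rewrite -/s -/l.
apply: (@le_trans _ _ (C * ((2 * (B + 1) * p) * l ^+ k.+1 / s + B * l ^+ k.+1 / s))).
  by apply: ler_wpM2l => //; rewrite lerD.
have : 0 <= l ^+ k.+1 / s by rewrite divr_ge0 ?exprn_ge0// ltW.
by rewrite /Q; lra.
Qed.

End Rate.

(** * The hitting time of the gap *)

Section Complexity.
Context {R : realType}.
Context (G : nat -> R) (Q : R) (m T0 : nat).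
Context (G_ge0 : forall r, 0 <= G r).
Context (Q_gt0 : 0 < Q).
Context (G_small : forall T, (T0 <= T)%N -> exists r, [/\ (1 <= r)%N,
  (r < 2 * T)%N & G r ^+ 2 <= Q * ln (2 * T)%:R ^+ m / Num.sqrt T%:R]).

(** Choosing T of order E (ln E)^(2 m + 2), with E = eps^-4, makes sqrt T exceed
    eps^-2 (ln E)^(m + 1), while ln (2 T) is at most (2 m + 7) ln E: the squared gap
    is at most eps^2 times a constant over ln E, and ln E outgrows the constant. *)
Lemma hitting_step : exists2 d : R, 0 < d & forall eps, 0 < eps -> eps < d ->
  exists r, [/\ (1 <= r)%N, G r <= eps
    & r%:R <= 4 * (eps ^- 4 * ln (eps ^- 4) ^+ (2 * m + 2))].
Proof.
pose c : R := (2 * m + 7)%:R ^+ m.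
have c0 : 0 < c by rewrite exprn_gt0// ltr0n addn_gt0 orbT.
(* The three quantities that ln E has to dominate. *)
pose L : R := 1 + Q * c + T0%:R.
have Qc0 : 0 < Q * c by rewrite mulr_gt0.
exists (expR (- L)); first exact: expR_gt0.
move=> eps e0 ed.
have L1 : 1 <= L by rewrite /L -addrA lerDl addr_ge0// ltW.
pose E := eps ^- 4; pose l := ln E.
have E0 : 0 < E by rewrite invr_gt0 exprn_gt0.
have lL : L <= l.
  rewrite /l /E lnV ?posrE ?exprn_gt0// lnXn//.
  have : ln eps <= - L.
    by rewrite -[X in _ <= X](expRK (- L : R)) ler_ln ?posrE ?expR_gt0// ltW.
  by rewrite -mulr_natl; lra.
have l1 : 1 <= l := le_trans L1 lL.
have l0 : 0 < l := lt_le_trans ltr01 l1.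
have lE : l < E by exact: ln_sublinear.
have E1 : 1 <= E by apply: le_trans l1 (ltW lE).
pose k := (2 * m + 2)%N; pose x := E * l ^+ k.
have lk1 : 1 <= l ^+ k by exact: exprn_ege1.
have Ex : E <= x by rewrite -[X in X <= _]mulr1 ler_wpM2l// ltW.
have x0 : 0 < x := lt_le_trans E0 Ex.
pose T := (Num.truncn x).+1.
have xT : x < T%:R by exact: truncnS_gt.
have Tx : T%:R <= 2 * x.
  have xx : (Num.truncn x)%:R <= x by rewrite truncn_le ltW.
  by rewrite /T -[_.+1%:R]natr1; have := le_trans E1 Ex; lra.
have TT0 : (T0 <= T)%N.
  rewrite -(ler_nat R); apply: le_trans (ltW xT); apply: le_trans Ex.
  apply: le_trans (ltW lE); apply: le_trans lL.
  by rewrite /L lerDr addr_ge0// ltW.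
have [r [r1 rT Gr]] := G_small TT0.
exists r; split=> //; last first.
  apply: (@le_trans _ _ (2 * T)%:R); first by rewrite ler_nat ltnW.
  by rewrite natrM -/E -/l -/k -/x; lra.
have T2 : 0 < (2 * T)%:R :> R by rewrite ltr0n.
have lnT : ln (2 * T)%:R <= (2 * m + 7)%:R * l.
  apply: (@le_trans _ _ (ln (4 * x))).
    by rewrite ler_ln ?posrE ?(mulr_gt0 _ x0)// natrM; lra.
  rewrite /x !lnM ?posrE ?mulr_gt0 ?exprn_gt0// lnXn// -/l -[ln l *+ k]mulr_natl.
  have h4 : ln 4 < 4 :> R by apply: ln_sublinear.
  have : k%:R * ln l <= k%:R * l.
    by rewrite ler_wpM2l// ltW//; exact: ln_sublinear.
  have -> : (2 * m + 7)%:R = k%:R + 5 :> R by rewrite -natrD /k -addnA.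
  by lra.
have lnT0 : 0 <= ln (2 * T)%:R :> R.
  by rewrite ln_ge0// ler1n.
have sT : eps ^- 2 * l ^+ m.+1 <= Num.sqrt T%:R.
  have y0 : 0 <= eps ^- 2 * l ^+ m.+1.
    by rewrite mulr_ge0 ?exprn_ge0 ?invr_ge0 ?exprn_ge0// ltW.
  rewrite -[X in X <= _](ger0_norm y0) -sqrtr_sqr ler_wsqrtr//.
  apply: le_trans (ltW xT); rewrite /x /E exprMn -exprM exprVn -exprM.
  by rewrite (_ : m.+1 * 2 = k)%N// /k mulnC mulnS addnC.
have y0 : 0 < eps ^- 2 * l ^+ m.+1.
  by rewrite mulr_gt0 ?exprn_gt0 ?invr_gt0 ?exprn_gt0.
rewrite -(@ler_pXn2r _ 2)// ?nnegrE ?G_ge0 ?(ltW e0)//.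
apply: (le_trans Gr).
apply: (@le_trans _ _ (Q * (c * l ^+ m) / (eps ^- 2 * l ^+ m.+1))).
  apply: ler_pM.
  - by rewrite mulr_ge0 ?exprn_ge0// ltW.
  - by rewrite invr_ge0 sqrtr_ge0.
  - apply: ler_wpM2l; first exact: ltW.
    by rewrite /c -exprMn lerXn2r// nnegrE// mulr_ge0// ltW.
  - by rewrite lef_pV2// posrE// (lt_le_trans y0).
have -> : Q * (c * l ^+ m) / (eps ^- 2 * l ^+ m.+1) = eps ^+ 2 * (Q * c / l).
  by rewrite [l ^+ m.+1]exprS; field; rewrite ?expf_neq0 ?gt_eqF.
rewrite -[X in _ <= X]mulr1 ler_wpM2l ?sqr_ge0// ler_pdivrMr// mul1r.
apply: le_trans lL; rewrite /L.
by have := ler0n R T0; lra.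
Qed.

(** A gap below a smaller threshold is also below eps, so the step found for small
    thresholds shows that the set of which T eps is the minimum is never empty. *)
Lemma hitting_time : exists T : R -> nat,
  (forall eps : R, 0 < eps ->
     is_least (fun r : nat => (1 <= r)%N /\ G r <= eps) (T eps)) /\
  softO (0 : R)^'+ (fun eps => (T eps)%:R) (fun eps => eps ^- 4).
Proof.
have [d d0 Hd] := hitting_step.
have least eps : exists n, 0 < eps ->
    is_least (fun r : nat => (1 <= r)%N /\ G r <= eps) n.
  have [e0|e0] := ltP 0 eps; last by exists 0%N.
  have e'0 : 0 < Num.min eps (d / 2) by rewrite lt_min e0 divr_gt0.
  have e'd : Num.min eps (d / 2) < d.
    by rewrite gt_min; apply/orP; right; rewrite ltr_pdivrMr// ltr_pMr// ltr1n.
  have [r [r1 Gr _]] := Hd _ e'0 e'd.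
  have ex : exists n, (1 <= n)%N && (G n <= eps).
    by exists r; rewrite r1 (le_trans Gr)// ge_min lexx.
  exists (ex_minn ex) => _; case: ex_minnP => n /andP[n1 Gn] nmin.
  by split=> // j [j1 Gj]; apply: nmin; rewrite j1.
have [T HT] := choice least.
exists T; split=> //; apply/softOP; exists (2 * m + 2)%N, 4; split=> //.
near=> eps.
have e0 : 0 < eps by near: eps; exact: nbhs_right_gt.
have ed : eps < d by near: eps; exact: nbhs_right_lt.
have [r [r1 Gr rle]] := Hd _ e0 ed.
have [_ Tmin] := HT _ e0.
rewrite ger0_norm//; apply: (@le_trans _ _ r%:R).
  by rewrite ler_nat; exact: Tmin.
apply: (le_trans rle); rewrite ler_wpM2l//.
by rewrite -normrX -normrM ler_norm.
Unshelve. all: by end_near.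
Qed.

End Complexity.

Theorem mainTheorem3 (R : realType) (K N M : nat)
  (f : 'M[R]_(K.+1, N) * 'rV[R]_M -> R)
  (h : 'I_K.+1 -> 'rV[R]_N -> R) (g : 'rV[R]_M -> R)
  (X : 'I_K.+1 -> set 'rV[R]_N) (Y : set 'rV[R]_M)
  (U : 'I_K.+1 -> 'rV[R]_N -> 'M[R]_(K.+1, N) -> 'rV[R]_M -> R)
  (F : 'M[R]_(K.+1, N) -> 'rV[R]_M)
  (Lx mu Lu : 'I_K.+1 -> R) (Ly rho : R)
  (gamma beta : nat -> R)
  (xs : nat -> 'M[R]_(K.+1, N)) (ys : nat -> 'rV[R]_M)
  (hA : assumptionA f h g X Y Lx Ly)
  (hB : assumptionB f X Y U mu Lu)
  (hrho : 0 < rho)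
  (hC3 : assumptionC3 rho Ly Lx mu gamma beta)
  (hrate : rate_parameters gamma beta)
  (hC4 : assumptionC4 f F)
  (halg : HiBSA f h g X Y U rho gamma beta xs ys) :
  exists T : R -> nat,
    (forall eps : R, 0 < eps ->
       is_least (fun r : nat => (1 <= r)%N /\
         enorm2 (gap f h g X Y (beta r.+1) rho (xs r.+1) (ys r.+1)) <= eps)
         (T eps)) /\
    softO (0 : R)^'+ (fun eps => (T eps)%:R) (fun eps => eps ^- 4).
Proof.
pose G r := enorm2 (gap f h g X Y (beta r.+1) rho (xs r.+1) (ys r.+1)).
have G0 r : 0 <= G r by exact: enorm2_ge0.
have [hL|/existsNP[i /negP]] := pselect (forall i, 0 <= Lx i).
  have [D [P [r0 [C [A [C0 A0 HD HP HG]]]]]] :=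
    gap_decrease hA hB hrho hC3 hC4 halg hL.
  have [Q [m [T0 [Q0 HQ]]]] := small_gap (G := G) hrate C0 A0 HD HP HG.
  exact: hitting_time G0 Q0 HQ.
rewrite -ltNge => Li.
have G1 r : (1 <= r)%N -> G r = 0.
  exact: (gap_eq0 hA hrho halg Li).
have GQ T : (1 <= T)%N -> exists r, [/\ (1 <= r)%N, (r < 2 * T)%N &
    G r ^+ 2 <= 1 * ln (2 * T)%:R ^+ 0 / Num.sqrt T%:R].
  move=> T1; exists T; split=> //; first by rewrite mul2n -addnn -{1}[T]addn0 ltn_add2l.
  by rewrite G1// expr0n/= mulr_ge0// ?mulr_ge0// invr_ge0 sqrtr_ge0.
exact: hitting_time G0 ltr01 GQ.
Qed.
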